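(* Let $n\ge3$ and $0<\alpha\le2$. Let $A_2\subset\mathbb R^n$ be a closed set with $c_\alpha(A_2)=\infty$ which is $\alpha$-thin at $\omega_{\mathbb R^n}$, assume that the open set $D:=\mathbb R^n\setminus A_2$ is connected, and let $A_1$ be a compact subset of $D$ with $c_\alpha(A_1)>0$. Let $\mathbf A=(A_1,A_2)$ with signs $s_1=+1$, $s_2=-1$. Then there exists a constraint $\boldsymbol\sigma=(\sigma^1,\sigma^2)\in\mathfrak C(\mathbf A)$ with $1<\sigma^1(A_1)<\infty$ and $\sigma^2(A_2)=\infty$ such that $$\kappa_\alpha(\boldsymbol\nu,\boldsymbol\nu)>\inf_{\boldsymbol\mu\in\mathcal E^{\boldsymbol\sigma}_\alpha(\mathbf A,\mathbf 1)}\kappa_\alpha(\boldsymbol\mu,\boldsymbol\mu)\quad\text{for every }\boldsymbol\nu\in\mathcal E^{\boldsymbol\sigma}_\alpha(\mathbf A,\mathbf 1).$$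
   Context: $\kappa_\alpha(\mu,\nu)=\iint|x-y|^{\alpha-n}d\mu(x)d\nu(y)$ for Radon measures on $\mathbb R^n$. $c_\alpha(Q)=[\inf\kappa_\alpha(\mu,\mu)]^{-1}$, the infimum over positive Radon measures $\mu$ of finite energy carried by $Q$ with $\mu(Q)=1$. $\omega_{\mathbb R^n}$ is the point at infinity of the one-point compactification. A closed set $F\subset\mathbb R^n$ is $\alpha$-thin at $\omega_{\mathbb R^n}$ if either $F$ is compact, or the inverse of $F$ relative to the unit sphere $S(0,1)$ has $x=0$ as an $\alpha$-irregular boundary point; equivalently (by Wiener's criterion), if $\sum_{k\in\mathbb N}c_\alpha(F_k)/q^{k(n-\alpha)}<\infty$, where $q>1$ and $F_k=F\cap\{x:q^k\le|x|<q^{k+1}\}$. For $\boldsymbol\mu=(\mu^1,\mu^2)$ with $\mu^i$ positive of finite energy supported by $A_i$, $\kappa_\alpha(\boldsymbol\mu,\boldsymbol\mu)=\sum_{i,j}s_is_j\kappa_\alpha(\mu^i,\mu^j)=\kappa_\alpha(\mu^1-\mu^2,\mu^1-\mu^2)$. Here the weights are $g_1=g_2=1$, the masses $a_1=a_2=1$ and there is no external field. $\mathfrak C(\mathbf A)$: all pairs $(\sigma^1,\sigma^2)$ of positive Radon measures on $\mathbb R^n$ with support of $\sigma^i$ equal to $A_i$ and $\sigma^i(A_i)>1$, $i=1,2$. $\mathcal E^{\boldsymbol\sigma}_\alpha(\mathbf A,\mathbf 1)$: all pairs $(\mu^1,\mu^2)$ of positive Radon measures with $\mu^i$ supported by $A_i$,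 $\kappa_\alpha(\mu^i,\mu^i)<\infty$, $\mu^i\le\sigma^i$ and $\mu^i(A_i)=1$, $i=1,2$. *)

(* Defs.v *)
From HB Require Import structures.
From mathcomp Require Import all_boot all_order all_algebra.
From mathcomp Require Import all_classical all_reals all_analysis.

Set Implicit Arguments.
Unset Strict Implicit.
Unset Printing Implicit Defensive.

Import Order.TTheory GRing.Theory Num.Theory.
Import numFieldNormedType.Exports.

Local Open Scope classical_set_scope.
Local Open Scope ring_scope.
Local Open Scope ereal_scope.

Section riesz.
Context {R : realType} {n : nat}.

Implicit Types (alpha : R) (x y : 'rV[R]_n) (Q A F : set 'rV[R]_n).

(* The library norm on ['rV[R]_n] is the sup norm; its topology is the
   Euclidean one, but the Riesz kernel needs the Euclidean norm. *)
Definition enorm x : R := Num.sqrt (\sum_(i < n) x ord0 i ^+ 2)%R.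

Definition borelRn := g_sigma_algebraType (@open 'rV[R]_n).

Notation msr := {measure set borelRn -> \bar R}.
Implicit Types (mu nu sigma : msr).

(* Borel measures on [R^n] that are finite on compact sets are regular. *)
Definition radon mu := forall K : set 'rV[R]_n, compact K -> mu K < +oo.

Definition msupport mu : set 'rV[R]_n :=
  [set x | forall U : set 'rV[R]_n, open_nbhs x U -> 0 < mu U].

(* [|x - y|^(alpha - n)] for [alpha < n]; the diagonal is separated because
   [powR 0 a = 0] for every [a != 0]. *)
Definition riesz_kernel alpha x y : \bar R :=
  if x == y then +oo else (enorm (x - y) `^ (alpha - n%:R))%:E.

Definition energy alpha mu nu : \bar R :=
  \int[mu]_x \int[nu]_y riesz_kernel alpha x y.

(* Meant for Borel [Q]. The infimum over the empty set is [+oo], and in [\bar R]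
   [0^-1 = +oo] and [+oo^-1 = 0]. *)
Definition capacity alpha Q : \bar R :=
  (ereal_inf [set energy alpha mu mu | mu in
     [set mu : msr | [/\ radon mu, energy alpha mu mu < +oo,
                         mu.-negligible (~` Q) & mu Q = 1]]])^-1.

(* Wiener's criterion at the point at infinity; whether the series converges
   does not depend on [q]. *)
Definition thin_at_infinity alpha F :=
  exists2 q : R, (1 < q)%R &
    \sum_(0 <= k <oo)
      capacity alpha (F `&` [set x | (q ^+ k <= enorm x < q ^+ k.+1)%R])
      * ((q `^ (k%:R * (n%:R - alpha)))^-1)%:E < +oo.

(* The sum of [s_i s_j energy (mu i) (mu j)] for the signs [+1] and [-1]. *)
Definition condenser_energy alpha (mu : msr * msr) : \bar R :=
  energy alpha mu.1 mu.1 - energy alpha mu.1 mu.2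
  - energy alpha mu.2 mu.1 + energy alpha mu.2 mu.2.

Definition constraints (A : set 'rV[R]_n * set 'rV[R]_n) : set (msr * msr) :=
  [set sigma | [/\ radon sigma.1, msupport sigma.1 = A.1 & 1 < sigma.1 A.1]
            /\ [/\ radon sigma.2, msupport sigma.2 = A.2 & 1 < sigma.2 A.2]].

Definition admissible_component alpha sigma A : set msr :=
  [set mu | [/\ radon mu, msupport mu `<=` A, energy alpha mu mu < +oo,
                forall B : set borelRn, measurable B -> mu B <= sigma B
              & mu A = 1]].

Definition admissible alpha (sigma : msr * msr)
    (A : set 'rV[R]_n * set 'rV[R]_n) : set (msr * msr) :=
  [set mu | admissible_component alpha sigma.1 A.1 mu.1
         /\ admissible_component alpha sigma.2 A.2 mu.2].

End riesz.

(* Main.v *)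
(* The first component of a competitor is left alone: given admissible
   (mu1, mu2), one constructs an admissible (mu1, mu2') of smaller energy. Put
   p = n - alpha. Besides countably many atoms, which are there only to give the
   constraints the prescribed supports and which no measure of finite energy
   charges, sigma2 is a series of measures nu_j on A2 of mass j + 1 and energy
   at most 1, living in {|x| >= r + j}; they exist since c(A2) = oo, because
   measures of small energy put little mass on a ball.
   For a constraint living far out, mu2 has too much mass. If its part of mass m
   on F_k satisfied kappa(mu2|F_k, mu2|F_k) <= kappa(mu1, mu2|F_k), which is at
   most 2^p q^(-kp) m, then m <= 2^p c(F_k) / q^(kp) by definition of the
   capacity; if this held for all k, then mu2 would have mass at most
   2^p times a tail of the Wiener series, that is, mass < 1. Hence thinning mu2
   slightly on some F_k strictly decreases the energy, and the missing mass is
   restored at infinity by a small multiple of nu_j, at a cost tending to 0. *)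

Require Import Defs.
From HB Require Import structures.
From mathcomp Require Import all_boot all_order all_algebra.
From mathcomp Require Import all_classical all_reals all_analysis.
From mathcomp Require Import ring lra measurable_realfun.
Import Order.TTheory GRing.Theory Num.Theory.
Import numFieldNormedType.Exports.
Local Open Scope classical_set_scope.
Local Open Scope ring_scope.
Local Open Scope ereal_scope.

Set Implicit Arguments.
Unset Strict Implicit.
Unset Printing Implicit Defensive.

(** * Euclidean norm and Borel sets *)

Section enorm.
Context {R : realType} {n : nat}.
Implicit Types (x y : 'rV[R]_n).
Local Notation T := (@borelRn R n).

Lemma enorm_ge0 x : (0 <= enorm x)%R.
Proof. exact: sqrtr_ge0. Qed.

Lemma sqr_enorm x : (enorm x ^+ 2 = \sum_(i < n) x ord0 i ^+ 2)%R.
Proof. by rewrite sqr_sqrtr// sumr_ge0// => i _; exact: sqr_ge0. Qed.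

Lemma enorm_eq0 x : (enorm x == 0%R) = (x == 0%R).
Proof.
rewrite -sqrf_eq0 sqr_enorm psumr_eq0; last by move=> i _; exact: sqr_ge0.
apply/allP/eqP => [h|->]; last by move=> i _ /=; rewrite mxE expr0n eqxx.
apply/rowP => i; rewrite mxE; apply/eqP; rewrite -sqrf_eq0.
by apply: h; rewrite mem_index_enum.
Qed.

Lemma enormN x : enorm (- x) = enorm x.
Proof. by congr Num.sqrt; apply: eq_bigr => i _; rewrite mxE sqrrN. Qed.

(** Young's inequality in each coordinate: with [a], [b] the two norms, (u + v)^2 <= (1 + b/a) u^2 +
    (1 + a/b) v^2, and these right-hand sides sum to (a + b)^2. *)
Lemma enormD x y : (enorm (x + y) <= enorm x + enorm y)%R.
Proof.
have [/eqP|x0] := eqVneq (enorm x) 0%R.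
  by rewrite enorm_eq0 => /eqP ->; rewrite add0r lerDr enorm_ge0.
have [/eqP|y0] := eqVneq (enorm y) 0%R.
  by rewrite enorm_eq0 => /eqP ->; rewrite addr0 lerDl enorm_ge0.
have {}x0 : (0 < enorm x)%R by rewrite lt0r x0 enorm_ge0.
have {}y0 : (0 < enorm y)%R by rewrite lt0r y0 enorm_ge0.
rewrite -(@ler_pXn2r _ 2)// ?nnegrE ?addr_ge0 ?enorm_ge0//.
set a := enorm x in x0 *; set b := enorm y in y0 *.
have H i : ((x + y)%R ord0 i ^+ 2 <=
    (1 + b / a) * x ord0 i ^+ 2 + (1 + a / b) * y ord0 i ^+ 2)%R.
  rewrite mxE -subr_ge0.
  set u := x _ _; set v := y _ _.
  rewrite (_ : (_ - _)%R = ((b * u - a * v) ^+ 2 / (a * b))%R); last first.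
    by field; rewrite !gt_eqF.
  by rewrite divr_ge0 ?sqr_ge0// mulr_ge0 ?ltW.
rewrite sqr_enorm; apply: (le_trans (ler_sum _ (fun i _ => H i))).
rewrite big_split/= -!mulr_sumr -!sqr_enorm -/a -/b.
by rewrite le_eqVlt; apply/orP; left; apply/eqP; field; rewrite !gt_eqF.
Qed.

Lemma enormB_ge x y : (enorm y - enorm x <= enorm (x - y))%R.
Proof.
rewrite lerBlDl -(enormN (x - y)) opprB.
by apply: le_trans (enormD _ _); rewrite addrC subrK.
Qed.

Lemma enormB_le x y : (enorm (x - y) <= enorm x + enorm y)%R.
Proof. by rewrite -(enormN y) enormD. Qed.

Lemma enorm_continuous : continuous (@enorm R n).
Proof.
move=> x; apply: continuous_comp; last exact: sqrt_continuous.
apply: (continuous_big (op := +%R) (x0 := 0%R)); first exact: add_continuous.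
move=> i _ y; apply: (@continuous_comp _ _ _
  (fun z : 'rV[R]_n => z ord0 i) (fun r : R => r ^+ 2)%R).
  exact: coord_continuous.
exact: exprn_continuous.
Qed.

Lemma open_borel (U : set 'rV[R]_n) : open U -> measurable (U : set T).
Proof. exact: sub_sigma_algebra. Qed.

Lemma closed_borel (F : set 'rV[R]_n) : closed F -> measurable (F : set T).
Proof.
move=> cF; rewrite -(setCK F); apply: measurableC.
by apply: open_borel; exact: (closed_openC cF).
Qed.

Lemma continuous_borel (f : 'rV[R]_n -> R) : continuous f ->
  measurable_fun setT (f : T -> R).
Proof.
move=> cf; apply: (measurability _ (RGenOpens.measurableE R)).
move=> _ [_ [a [b ->]] <-]; rewrite setTI; apply: open_borel.
by apply: open_comp => [x _|]; [exact: cf|exact: interval_open].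
Qed.

Lemma measurable_enormB :
  measurable_fun setT (fun z : T * T => enorm (z.1 - z.2 : 'rV[R]_n)).
Proof.
rewrite /enorm.
apply: (measurableT_comp (f := @Num.sqrt R)).
  exact: continuous_measurable_fun (@sqrt_continuous R).
apply: measurable_sum => i.
apply: measurable_funX.
rewrite (_ : (fun z : T * T => _) = (fun z : T * T =>
  (fun x : 'rV[R]_n => x ord0 i) z.1 - (fun x : 'rV[R]_n => x ord0 i) z.2)%R).
  apply: measurable_funB.
  - apply: (measurableT_comp (f := (fun x : T => (x : 'rV[R]_n) ord0 i))) => //.
    by apply: continuous_borel; exact: coord_continuous.
  - apply: (measurableT_comp (f := (fun x : T => (x : 'rV[R]_n) ord0 i))) => //.
    by apply: continuous_borel; exact: coord_continuous.
by apply/funext => z; rewrite !mxE.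
Qed.

End enorm.

(** * The energy as a bilinear form *)

(** Tonelli applies to a bundled finite measure; restricting [nu] to [setT] with [mfrestr] bundles
    the hypothesis [nu setT < +oo] and leaves all integrals unchanged. *)
Lemma measurable_integral_section d1 d2 (T1 : measurableType d1)
    (T2 : measurableType d2) (R : realType) (nu : {measure set T2 -> \bar R})
    (f : T1 * T2 -> \bar R) :
  nu setT < +oo -> measurable_fun setT f -> (forall z, 0 <= f z) ->
  measurable_fun setT (fun x => \int[nu]_y f (x, y)).
Proof.
move=> nuT mf f0.
rewrite (_ : (fun x => _) = fubini_F (mfrestr measurableT nuT) f).
  exact: measurable_fun_fubini_tonelli_F.
apply/funext => x; apply: eq_measure_integral => B mB _.
by rewrite /= /mfrestr /mrestr setIT.
Qed.

Section energy.
Context {R : realType} {n : nat} (alpha : R).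
Local Notation T := (@borelRn R n).
Local Notation k := (@riesz_kernel R n alpha).
Implicit Types (x y : 'rV[R]_n) (mu nu : {measure set T -> \bar R}).

Lemma riesz_kernel_ge0 x y : 0 <= k x y.
Proof.
by rewrite /riesz_kernel; case: ifP => // _; rewrite lee_fin powR_ge0.
Qed.

Lemma riesz_kernel_le x y (d : R) : (alpha < n%:R)%R -> (0 < d)%R ->
  (d <= enorm (x - y))%R -> k x y <= (d `^ (alpha - n%:R))%:E.
Proof.
move=> an d0 dxy; rewrite /riesz_kernel; case: eqP => [xy|_].
  move: dxy; rewrite xy subrr (eqP (_ : enorm 0 == 0%R)) ?enorm_eq0//.
  by move=> /(lt_le_trans d0); rewrite ltxx.
have xy0 := lt_le_trans d0 dxy.
have e : (alpha - n%:R = - (n%:R - alpha))%R by rewrite opprB.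
rewrite lee_fin e !powRN lef_pV2 ?posrE ?powR_gt0//.
by apply: ge0_ler_powR => //; rewrite ?nnegrE ?subr_ge0 ltW.
Qed.

Lemma riesz_kernel_ge x y (d : R) : (alpha < n%:R)%R -> (0 < d)%R ->
  (enorm (x - y) <= d)%R -> (d `^ (alpha - n%:R))%:E <= k x y.
Proof.
move=> an d0 dxy; rewrite /riesz_kernel; case: eqP => [xy|xy].
  exact: leey.
have xy0 : (0 < enorm (x - y))%R.
  by rewrite lt0r enorm_ge0 andbT enorm_eq0 subr_eq0; apply/eqP.
have e : (alpha - n%:R = - (n%:R - alpha))%R by rewrite opprB.
rewrite lee_fin e !powRN lef_pV2 ?posrE ?powR_gt0//.
by apply: ge0_ler_powR => //; rewrite ?nnegrE ?subr_ge0 ltW.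
Qed.

(** The kernel is a function of the distance alone: the test [x == y] becomes a test of
    [enorm (x - y)] against 0. *)
Lemma measurable_riesz_kernel :
  measurable_fun setT (fun z : T * T => k z.1 z.2).
Proof.
have -> : (fun z : T * T => k z.1 z.2) =
    (fun r : R => if r == 0%R then +oo else (r `^ (alpha - n%:R))%:E) \o
    (fun z : T * T => enorm (z.1 - z.2 : 'rV[R]_n)).
  by apply/funext => z /=; rewrite /riesz_kernel enorm_eq0 subr_eq0.
apply: measurableT_comp; last exact: measurable_enormB.
apply: measurable_fun_if => //=.
- exact: measurable_fun_eqr.
- apply: measurable_funTS; apply/measurable_EFinP; exact: measurable_powR.
Qed.

Lemma measurable_riesz_kernelr x : measurable_fun setT (k x : T -> \bar R).
Proof.
exact: (measurableT_comp measurable_riesz_kernel (pair1_measurable (x : T))).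
Qed.

Lemma measurable_potential nu : nu setT < +oo ->
  measurable_fun setT (fun x : T => \int[nu]_y k x y).
Proof.
move=> nuT.
apply: (measurable_integral_section (f := fun z : T * T => k z.1 z.2)) => //.
  exact: measurable_riesz_kernel.
by move=> z; exact: riesz_kernel_ge0.
Qed.

Lemma potential_ge0 nu x : 0 <= \int[nu]_y k x y.
Proof. by apply: integral_ge0 => y _; exact: riesz_kernel_ge0. Qed.

Lemma energy_ge0 mu nu : 0 <= energy alpha mu nu.
Proof. by apply: integral_ge0 => x _; exact: potential_ge0. Qed.

Lemma eq_energy mu mu' nu nu' :
  (forall B, measurable B -> mu B = mu' B) ->
  (forall B, measurable B -> nu B = nu' B) ->
  energy alpha mu nu = energy alpha mu' nu'.
Proof.
move=> mm nn; rewrite /energy (eq_measure_integral mu'); last first.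
  by move=> B mB _; exact: mm.
apply: eq_integral => x _; apply: eq_measure_integral => B mB _; exact: nn.
Qed.

(** Here and in the next three lemmas, finiteness makes the potentials measurable, as additivity of
    the integral requires. *)
Lemma energyDl mu mu' nu : nu setT < +oo ->
  energy alpha (measure_add mu mu') nu =
  energy alpha mu nu + energy alpha mu' nu.
Proof.
move=> nuT; rewrite /energy ge0_integral_measure_add//.
- by move=> x _; exact: potential_ge0.
- exact: measurable_potential.
Qed.

Lemma energyDr mu nu nu' : nu setT < +oo -> nu' setT < +oo ->
  energy alpha mu (measure_add nu nu') =
  energy alpha mu nu + energy alpha mu nu'.
Proof.
move=> nuT nuT'; rewrite /energy -ge0_integralD//.
- apply: eq_integral => x _; rewrite ge0_integral_measure_add//.
  + by move=> y _; exact: riesz_kernel_ge0.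
  + exact: measurable_riesz_kernelr.
- by move=> x _; exact: potential_ge0.
- exact: measurable_potential.
- by move=> x _; exact: potential_ge0.
- exact: measurable_potential.
Qed.

Lemma energyZl (c : {nonneg R}) mu nu : nu setT < +oo ->
  energy alpha (mscale c mu) nu = c%:num%:E * energy alpha mu nu.
Proof.
move=> nuT; rewrite /energy ge0_integral_mscale//.
- exact: measurable_potential.
- by move=> x _; exact: potential_ge0.
Qed.

Lemma energyZr (c : {nonneg R}) mu nu : nu setT < +oo ->
  energy alpha mu (mscale c nu) = c%:num%:E * energy alpha mu nu.
Proof.
move=> nuT; rewrite /energy -ge0_integralZl//.
- apply: eq_integral => x _; rewrite ge0_integral_mscale//.
  + exact: measurable_riesz_kernelr.
  + by move=> y _; exact: riesz_kernel_ge0.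
- exact: measurable_potential.
- by move=> x _; exact: potential_ge0.
Qed.

Section concentrated.
Variables (mu nu : {measure set T -> \bar R}) (A B : set T) (c : R).
Hypotheses (mA : measurable A) (mB : measurable B) (c0 : (0 <= c)%R).
Hypotheses (muA : mu (~` A) = 0) (nuB : nu (~` B) = 0).
Hypotheses (nuT : nu setT < +oo).

(** A kernel bound on [A] times [B] holds almost everywhere for both measures, so it can be
    integrated twice. *)
Lemma energy_le : (forall x y, A x -> B y -> k x y <= c%:E) ->
  energy alpha mu nu <= c%:E * nu setT * mu setT.
Proof.
move=> kc; rewrite -[leRHS]integral_cst//.
apply: ae_ge0_le_integral => //.
- by move=> x _; exact: potential_ge0.
- exact: measurable_potential.
- by move=> x _; rewrite mule_ge0.
- exists (~` A); split => //; first exact: measurableC.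
  apply: subsetC => x Ax _ /=.
  rewrite -integral_cst//; apply: ae_ge0_le_integral => //.
  + by move=> y _; exact: riesz_kernel_ge0.
  + exact: measurable_riesz_kernelr.
  + exists (~` B); split => //; first exact: measurableC.
    by apply: subsetC => y By _; exact: kc.
Qed.

Lemma energy_ge : (forall x y, A x -> B y -> c%:E <= k x y) ->
  c%:E * nu setT * mu setT <= energy alpha mu nu.
Proof.
move=> kc; rewrite -[leLHS]integral_cst//.
apply: ae_ge0_le_integral => //.
- by move=> x _; rewrite mule_ge0.
- by move=> x _; exact: potential_ge0.
- exact: measurable_potential.
- exists (~` A); split => //; first exact: measurableC.
  apply: subsetC => x Ax _ /=.
  rewrite -integral_cst//; apply: ae_ge0_le_integral => //.
  + by move=> y _; exact: riesz_kernel_ge0.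
  + exact: measurable_riesz_kernelr.
  + exists (~` B); split => //; first exact: measurableC.
    by apply: subsetC => y By _; exact: kc.
Qed.

End concentrated.
End energy.

(** * Restrictions, atoms and far away measures *)

Section restriction.
Context {R : realType} {n : nat} (alpha : R).
Local Notation T := (@borelRn R n).
Implicit Types (mu nu : {measure set T -> \bar R}).

Lemma measure_lty mu (D : set T) : measurable D -> mu setT < +oo -> mu D < +oo.
Proof.
by move=> mD; apply: le_lt_trans; apply: le_measure => //; rewrite inE.
Qed.

Lemma measureTC mu (D : set T) : measurable D -> mu setT = mu D + mu (~` D).
Proof.
move=> mD; rewrite -(setUv D) measureU//; first exact: measurableC.
by rewrite setICr.
Qed.

Lemma mrestr_lty mu (D : set T) (mD : measurable D) :
  mu setT < +oo -> mrestr mu mD setT < +oo.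
Proof. by move=> muT; rewrite /mrestr setTI measure_lty. Qed.

Lemma mrestrC0 mu (D : set T) (mD : measurable D) : mrestr mu mD (~` D) = 0.
Proof. by rewrite /mrestr setICl measure0. Qed.

Lemma mrestrDC mu (D : set T) (mD : measurable D) B : measurable B ->
  mu B = measure_add (mrestr mu mD) (mrestr mu (measurableC mD)) B.
Proof.
by move=> mB; rewrite measure_addE /= /mrestr -setDE addeC -measureDI.
Qed.

Lemma energy_splitl mu nu (D : set T) (mD : measurable D) : nu setT < +oo ->
  energy alpha mu nu = energy alpha (mrestr mu mD) nu
                     + energy alpha (mrestr mu (measurableC mD)) nu.
Proof.
move=> nuT; rewrite -energyDl//; apply: eq_energy => // B mB.
exact: mrestrDC.
Qed.

Lemma energy_splitr mu nu (D : set T) (mD : measurable D) : nu setT < +oo ->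
  energy alpha mu nu = energy alpha mu (mrestr nu mD)
                     + energy alpha mu (mrestr nu (measurableC mD)).
Proof.
move=> nuT; rewrite -energyDr ?mrestr_lty//.
by apply: eq_energy => // B mB; exact: mrestrDC.
Qed.

Lemma energy_mrestrl mu nu (D : set T) (mD : measurable D) : nu setT < +oo ->
  energy alpha (mrestr mu mD) nu <= energy alpha mu nu.
Proof.
by move=> nuT; rewrite (@energy_splitl mu nu D mD)// leeDl// energy_ge0.
Qed.

Lemma energy_mrestrr mu nu (D : set T) (mD : measurable D) : nu setT < +oo ->
  energy alpha mu (mrestr nu mD) <= energy alpha mu nu.
Proof.
by move=> nuT; rewrite (@energy_splitr mu nu D mD)// leeDl// energy_ge0.
Qed.

Lemma energy_mrestr mu (D : set T) (mD : measurable D) : mu setT < +oo ->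
  energy alpha (mrestr mu mD) (mrestr mu mD) <= energy alpha mu mu.
Proof.
move=> muT; apply: le_trans (energy_mrestrl mu mD muT).
exact: energy_mrestrr.
Qed.

Lemma borel_set1 (x : 'rV[R]_n) : measurable ([set x] : set T).
Proof.
apply: closed_borel; apply: accessible_closed_set1.
exact: hausdorff_accessible.
Qed.

(** The kernel is [+oo] on the diagonal, so an atom of mass [m] has energy at least [c * m * m] for
    every real [c >= 0]. *)
Lemma energy_no_atom mu x : mu setT < +oo -> energy alpha mu mu < +oo ->
  mu [set x] = 0.
Proof.
move=> muT Ioo; have mx := borel_set1 x.
have fm : mu [set x] \is a fin_num by rewrite ge0_fin_numE// measure_lty.
set m := fine (mu [set x]).
have mE : mu [set x] = m%:E by rewrite fineK.
have m0 : (0 <= m)%R by rewrite fine_ge0.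
have fI : energy alpha mu mu \is a fin_num by rewrite ge0_fin_numE// energy_ge0.
have H c : (0 <= c)%R -> (c * m * m <= fine (energy alpha mu mu))%R.
  move=> c0; rewrite -lee_fin fineK// !EFinM -mE.
  apply: le_trans (energy_mrestr mx muT).
  have := @energy_ge _ _ alpha (mrestr mu mx) (mrestr mu mx) [set x] [set x] c
    mx mx c0 (mrestrC0 _ _) (mrestrC0 _ _) (mrestr_lty mx muT).
  rewrite /= /mrestr setTI; apply.
  by move=> _ _ -> ->; rewrite /riesz_kernel eqxx leey.
rewrite mE; congr EFin; apply/eqP; apply: contraT => mn0.
have m20 : (0 < m * m)%R by rewrite mulr_gt0// lt0r mn0.
have I0 : (0 <= fine (energy alpha mu mu))%R by rewrite fine_ge0// energy_ge0.
(* With this [c] the bound [H] reads I + 1 <= I, where I is the energy of [mu]. *)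
have := H ((fine (energy alpha mu mu) + 1) / (m * m))%R.
rewrite -mulrA divfK ?gt_eqF// => /(_ (divr_ge0 (addr_ge0 I0 ler01) (ltW m20))).
by rewrite gerDl ler10.
Qed.

Lemma borel_range (x : nat -> 'rV[R]_n) : measurable (range x : set T).
Proof.
rewrite -[range x]bigcup_imset1; apply: bigcup_measurable => k _.
exact: borel_set1.
Qed.

Lemma energy_range0 mu (x : nat -> 'rV[R]_n) : mu setT < +oo ->
  energy alpha mu mu < +oo -> mu (range x) = 0.
Proof.
move=> muT Ioo; apply/eqP; rewrite eq_le measure_ge0 andbT.
have : (range x : set T) `<=` \bigcup_k [set x k].
  by move=> _ [k _ <-]; exists k.
move/(measure_sigma_subadditive mu (fun k => borel_set1 (x k)) (borel_range x)).
move=> /le_trans; apply.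
by rewrite eseries0// => k _ _; exact: energy_no_atom.
Qed.

End restriction.

(** * Measures of small energy far out *)

Section sparse.
Context {R : realType} {n : nat} (alpha : R).
Local Notation T := (@borelRn R n).

Lemma measurable_enorm_ge r : measurable ([set x | (r <= enorm x)%R] : set T).
Proof.
rewrite (_ : mkset _ = (@enorm R n) @^-1` `[r, +oo[%classic).
  rewrite -[X in measurable X]setTI.
  exact: (continuous_borel (@enorm_continuous R n)).
by apply/seteqP; split=> x /=; rewrite in_itv/= andbT.
Qed.

Lemma measurable_enorm_lt r : measurable ([set x | (enorm x < r)%R] : set T).
Proof.
rewrite (_ : mkset _ = (@enorm R n) @^-1` `]-oo, r[%classic).
  rewrite -[X in measurable X]setTI.
  exact: (continuous_borel (@enorm_continuous R n)).
by apply/seteqP; split=> x /=; rewrite in_itv/=.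
Qed.

(** Infinite capacity provides unit measures on [A] of arbitrarily small energy. On the ball of
    radius [r] the kernel is at least [kap], so such a measure has little mass there; that part is
    discarded and the rest rescaled to mass [M]. *)
Lemma capacityy_far_measure (A : set 'rV[R]_n) (r M : R) : (alpha < n%:R)%R ->
  closed A -> capacity alpha A = +oo -> (0 < r)%R -> (0 < M)%R ->
  exists nu : {measure set T -> \bar R}, [/\ nu setT = M%:E,
    nu (~` (A `&` [set x | (r <= enorm x)%R])) = 0 & energy alpha nu nu <= 1].
Proof.
move=> an cA capA r0 M0.
have mA := closed_borel cA.
set B := ([set x | (enorm x < r)%R] : set T).
have mB : measurable B := measurable_enorm_lt r.
set kap : R := ((r + r) `^ (alpha - n%:R))%R.
have kap0 : (0 < kap)%R by rewrite powR_gt0// addr_gt0.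
(* The bound [kap / 4] forces mass below 1/2 on the ball; the other one absorbs the factor
   [(2 * M) ^+ 2] produced by the rescaling. *)
set dl : R := (Num.min (kap / 4) (4 * M ^+ 2)^-1)%R.
have dl0 : (0 < dl)%R.
  by rewrite lt_min divr_gt0//= invr_gt0 mulr_gt0// exprn_gt0.
(* The inverse is [+oo] only at 0, so the infimum of the energies vanishes. *)
move: capA; rewrite /capacity; set S := [set _ | mu in _] => /eqP.
rewrite inve_eqy => /eqP infS.
have : ereal_inf S < dl%:E by rewrite infS lte_fin.
move=> /ereal_inf_lt[_ [mu [radmu Ioo negA muA] <-] Idl].
have muCA : mu (~` A) = 0.
  by apply: measure_negligible => //; exact: measurableC.
have muT : mu setT = 1.
  by rewrite (measureTC mu mA) [X in X + _]muA [X in _ + X]muCA adde0.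
have muToo : mu setT < +oo by rewrite muT ltry.
have fm : mu B \is a fin_num by rewrite ge0_fin_numE// measure_lty.
set m := fine (mu B).
have mE : mu B = m%:E by rewrite fineK.
have m0 : (0 <= m)%R by rewrite fine_ge0.
have : (kap * m * m < dl)%R.
  rewrite -lte_fin; apply: le_lt_trans Idl.
  apply: le_trans (energy_mrestr alpha mB muToo).
  have := @energy_ge _ _ alpha (mrestr mu mB) (mrestr mu mB) B B kap
    mB mB (ltW kap0) (mrestrC0 _ _) (mrestrC0 _ _) (mrestr_lty mB muToo).
  rewrite /= /mrestr setTI !EFinM -mE; apply => x y Bx By.
  apply: riesz_kernel_ge => //; first exact: addr_gt0.
  by apply: le_trans (enormB_le _ _) _; apply: lerD; exact: ltW.
move=> kmd.
have m12 : (m < 2^-1)%R.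
  have : (kap * m * m < kap * (2^-1 * 2^-1))%R.
    apply: lt_le_trans kmd _; rewrite /dl ge_min; apply/orP; left.
    by rewrite -invfM -natrM.
  rewrite -mulrA ltr_pM2l// => h; rewrite ltNge; apply/negP => h'.
  by move: h; rewrite ltNge => /negP; apply; rewrite ler_pM.
have m1 : (0 < 1 - m)%R by lra.
have c0 : (0 <= M / (1 - m))%R by rewrite divr_ge0// ltW.
pose c := NngNum c0.
have mCB := measurableC mB.
have muCB : mu (~` B) = (1 - m)%:E.
  by rewrite EFinB -muT (measureTC mu mB) -mE addeAC subee// add0e.
exists (mscale c (mrestr mu mCB)); split.
- rewrite /= /mscale /= /mrestr setTI [X in _ * X]muCB -EFinM/=.
  by rewrite divfK// gt_eqF.
- rewrite /= /mscale /= /mrestr; apply/eqP; rewrite mule_eq0.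
  apply/orP; right; apply/eqP.
  apply: (subset_measure0 _ _ _ muCA).
  + apply: measurableI => //; apply: measurableC; apply: measurableI => //.
    exact: measurable_enorm_ge.
  + exact: measurableC.
  + move=> x /= [nAr nB] Ax; apply: nAr; split => //=.
    by rewrite leNgt; exact/negP.
- rewrite energyZr ?mrestr_lty// energyZl ?mrestr_lty//.
  have fI : energy alpha (mrestr mu mCB) (mrestr mu mCB) <= dl%:E.
    by apply: le_trans (ltW Idl); exact: energy_mrestr.
  have cc : 0 <= (c%:num%:E : \bar R) by rewrite lee_fin.
  apply: (@le_trans _ _ (c%:num%:E * (c%:num%:E * dl%:E))).
    by rewrite !lee_wpmul2l.
  rewrite -!EFinM lee_fin/=.
  (* More than half of the mass survives outside the ball. *)
  have cM : (M / (1 - m) <= 2 * M)%R.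
    by rewrite ler_pdivrMr//; nra.
  apply: (@le_trans _ _ (2 * M * (2 * M * (4 * M ^+ 2)^-1))%R).
    apply: ler_pM => //; first by rewrite mulr_ge0// ltW.
    by apply: ler_pM => //; [exact: ltW|rewrite /dl ge_min lexx orbT].
  by rewrite le_eqVlt; apply/orP; left; apply/eqP; field; rewrite gt_eqF.
Qed.

End sparse.

(** * Dense atomic measures *)

Section atoms.
Context {R : realType} {n : nat}.
Local Notation T := (@borelRn R n).

(** One point of [A] is chosen in each ball with rational centre and radius [m.+1%:R^-1] that meets
    [A]; the countably many balls are enumerated by [unpickle]. *)
Lemma dense_sequence (A : set 'rV[R]_n) : A !=set0 ->
  exists x : nat -> 'rV[R]_n, (forall k, A (x k)) /\
    forall U, open U -> U `&` A !=set0 -> exists k, U (x k).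
Proof.
move=> [a Aa].
pose B (p : 'rV[rat]_n * nat) :=
  A `&` ball (map_mx ratr p.1 : 'rV[R]_n) (p.2.+1%:R^-1)%R.
(* The default [a] keeps the sequence in [A] when the ball misses [A]. *)
pose y p : 'rV[R]_n := if pselect (B p !=set0) then xget a (B p) else a.
have Ay p : A (y p).
  rewrite /y; case: pselect => // -[z Bz].
  by have [] := xgetPex a (ex_intro _ z Bz).
exists (fun k => if unpickle k is Some p then y p else a); split.
  by move=> k; case: unpickle.
move=> U oU [z [Uz Az]].
have /nbhs_ballP[e /= e0 zU] : nbhs z U by exact: open_nbhs_nbhs.
have [m me] : exists m, (m.+1%:R^-1 < e / 2)%R.
  have e20 := divr_gt0 e0 (ltr0Sn R 1).
  have [m _ /(_ _ (leqnn m)) h] := near_infty_natSinv_lt (PosNum e20).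
  by exists m.
have m0 : (0 < m.+1%:R^-1 :> R)%R by rewrite invr_gt0.
have /choice[q zq] : forall i : 'I_n, exists q : rat,
    (`|ratr q - z ord0 i| < m.+1%:R^-1)%R.
  move=> i; have [|q] := @rat_in_itvoo R
    (z ord0 i - m.+1%:R^-1) (z ord0 i + m.+1%:R^-1)%R.
    by rewrite ltrD2l gtrN.
  by rewrite in_itv/= => /andP[q1 q2]; exists q; rewrite ltr_distl q1.
pose Q := (\row_i q i)%R.
have Bz : B (Q, m) z.
  split => //; split => // i j; rewrite /ball/= !mxE /ball_ (ord1 i); exact: zq.
exists (pickle (Q, m)); rewrite pickleK; apply: zU.
have [_ By] : B (Q, m) (y (Q, m)).
  by rewrite /y; case: pselect => [h|[]]; [exact: xgetPex|exists z].
have [_ /ball_sym zB] := Bz.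
(* Both [z] and the chosen point are within [e / 2] of the rational centre. *)
rewrite [e]splitr.
apply: (@ball_triangle _ _ (map_mx ratr Q : 'rV[R]_n)).
  exact: (le_ball (ltW me)).
exact: (le_ball (ltW me)).
Qed.

(** Weights 1/2, 1/4, 1/8, ... are put on a dense sequence of [A]; repeated points simply accumulate
    their weights. *)
Lemma dense_atoms (A : set 'rV[R]_n) : A !=set0 ->
  exists (x : nat -> 'rV[R]_n) (dl : {measure set T -> \bar R}),
    [/\ range x `<=` A, dl setT = 1, dl (~` range x) = 0 &
      forall U, open U -> U `&` A !=set0 -> 0 < dl U].
Proof.
move=> /dense_sequence[x [Ax xU]].
have w0 k : (0 <= 1 / (2 ^ (k + 1))%:R :> R)%R by rewrite divr_ge0.
pose d k : {measure set T -> \bar R} := mscale (NngNum (w0 k)) (\d_(x k : T)).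
have dE k B : measurable B ->
    d k B = ((1 / (2 ^ (k + 1))%:R) * (x k \in B)%:R)%:E.
  by move=> mB; rewrite /d /= /mscale/= diracE EFinM.
exists x, (mseries d 0); split.
- by move=> _ [k _ <-].
- rewrite /mseries/=; apply: cvg_lim => //.
  have := @cvg_geometric_eseries_half R 1 0; rewrite expr0 divr1.
  apply: cvg_trans; apply: near_eq_cvg; near=> N.
  by apply: eq_bigr => k _; rewrite dE// in_setT mulr1.
- rewrite /=/mseries. rewrite eseries0// => k _ _.
  rewrite dE; last by apply: measurableC; exact: borel_range.
  rewrite (_ : _ \in _ = false) ?mulr0//; apply/negbTE.
  rewrite notin_setE => /=.
  by apply; exists k.
- move=> U oU /(xU _ oU)[k Uk].
  have mU := open_borel oU.
  rewrite /= /mseries (nneseriesD1 (n := k))//.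
  rewrite (@lt_le_trans _ _ (d k U))//.
    rewrite dE// mem_set// mulr1 lte_fin divr_gt0// ltr0n expn_gt0//.
  rewrite leeDl// nneseries_ge0// => i _ _; exact: measure_ge0.
Unshelve. all: by end_near. Qed.

End atoms.

(** * Capacity of annuli *)

Section rings.
Context {R : realType} {n : nat} (alpha : R).
Local Notation T := (@borelRn R n).
Implicit Types (mu : {measure set T -> \bar R}).

Lemma capacity_ge0 (F : set 'rV[R]_n) : 0 <= capacity alpha F.
Proof.
rewrite /capacity inve_ge0; apply/ereal_infP => _ [mu _ <-].
exact: energy_ge0.
Qed.

Lemma finite_radon mu : mu setT < +oo -> radon mu.
Proof.
move=> muT K cK; apply: measure_lty => //; apply: closed_borel.
by apply: compact_closed => //; exact: norm_hausdorff.
Qed.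

(** With [m] the mass on [F], the normalized measure competes in the definition of the capacity and
    has energy at most [C / m]; inverting the infimum gives the bound. *)
Lemma mass_le_capacity mu (F : set 'rV[R]_n) (C : R) : measurable (F : set T) ->
  mu (~` F) = 0 -> mu setT < +oo -> capacity alpha F < +oo -> (0 <= C)%R ->
  energy alpha mu mu <= C%:E * mu F -> mu F <= C%:E * capacity alpha F.
Proof.
move=> mF muCF muT capF C0 Ile.
have fm : mu F \is a fin_num by rewrite ge0_fin_numE// measure_lty.
have muFT : mu setT = mu F by rewrite (measureTC mu mF) [X in _ + X]muCF adde0.
set m := fine (mu F); have mE : mu F = m%:E by rewrite fineK.
have m0 : (0 <= m)%R by rewrite fine_ge0.
rewrite mE in Ile *.
have [->|mn0] := eqVneq m 0%R; first by rewrite mule_ge0// capacity_ge0.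
have {mn0}m0 : (0 < m)%R by rewrite lt0r mn0.
have c0 : (0 <= m^-1)%R by rewrite invr_ge0 ltW.
pose c := NngNum c0.
have cT : mscale c mu setT < +oo by rewrite /mscale muFT mE -EFinM ltry.
have Ic : energy alpha (mscale c mu) (mscale c mu) <= (C / m)%:E.
  rewrite energyZr// energyZl//=.
  apply: (@le_trans _ _ (m^-1%:E * (m^-1%:E * (C%:E * m%:E)))).
    by rewrite !lee_wpmul2l// lee_fin.
  rewrite -!EFinM lee_fin le_eqVlt; apply/orP; left; apply/eqP; field.
  by rewrite gt_eqF.
move: capF; rewrite /capacity; set S := [set _ | mu in _].
have SI : ereal_inf S <= (C / m)%:E.
  apply: (le_trans _ Ic); apply: ereal_inf_lbound.
  exists (mscale c mu) => //; split.
  - exact: finite_radon.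
  - by apply: le_lt_trans Ic _; rewrite ltry.
  - exists (~` F); split => //; first exact: measurableC.
    by rewrite /= /mscale [X in _ * X]muCF mule0.
  - by rewrite /= /mscale [X in _ * X]mE -EFinM/= mulVf// gt_eqF.
have S0 : 0 <= ereal_inf S.
  by apply/ereal_infP => _ [nu _ <-]; exact: energy_ge0.
case: (ereal_inf S) SI S0 => [i|//|//]; rewrite !lee_fin => iC i0.
(* An infimum equal to 0 would make the capacity [+oo], which is excluded. *)
rewrite inver; case: eqVneq => // in0 _; rewrite -EFinM lee_fin.
have {in0}i0 : (0 < i)%R by rewrite lt0r in0.
by rewrite ler_pdivlMr// mulrC -ler_pdivlMr.
Qed.

Lemma expr_unbounded (q r : R) : (1 < q)%R -> exists k, (r < q ^+ k)%R.
Proof.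
move=> q1; have q0 : (0 < q)%R by exact: lt_trans q1.
have : (q^-1 ^+ k)%R @[k --> \oo] --> (0 : R)%R.
  by apply: cvg_expr; rewrite ger0_norm ?invr_ge0 ?ltW// invf_lt1.
have r1 : (0 < (`|r| + 1)^-1)%R by rewrite invr_gt0 ltr_wpDl.
move=> /cvgr_lt - /(_ _ r1)[k _ /(_ _ (leqnn k))] /=.
rewrite exprVn ltf_pV2 ?posrE ?exprn_gt0// ?ltr_wpDl// => h.
exists k; apply: lt_trans h; apply: le_lt_trans (ler_norm r) _.
by rewrite ltrDl.
Qed.

Definition annulus (q : R) (k : nat) : set 'rV[R]_n :=
  [set x | (q ^+ k <= enorm x < q ^+ k.+1)%R].

Lemma measurable_annulus q k : measurable (annulus q k : set T).
Proof.
rewrite (_ : annulus q k = [set x | (q ^+ k <= enorm x)%R] `&`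
    [set x | (enorm x < q ^+ k.+1)%R]).
  apply: measurableI; first exact: measurable_enorm_ge.
  exact: measurable_enorm_lt.
by apply/seteqP; split => x /= => [/andP[]|[a b]]; [split|exact/andP].
Qed.

Lemma annulus_cover q K (x : 'rV[R]_n) : (1 < q)%R -> (q ^+ K <= enorm x)%R ->
  exists k, annulus q (k + K) x.
Proof.
move=> q1 Kx; have := expr_unbounded (enorm x) q1.
move=> /[dup] ex /(ex_minnP)[k xk kmin].
have Kk : (K < k)%N.
  rewrite ltnNge; apply/negP => kK; move: xk; rewrite ltNge => /negP; apply.
  by apply: le_trans Kx; rewrite ler_weXn2l// ltW.
(* As [k] is the least exponent with [enorm x < q ^+ k], the point lies in the annulus of index
   [k.-1], which is at least [K]. *)
exists (k.-1 - K)%N; rewrite subnK; last first.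
  by rewrite -ltnS prednK// (leq_ltn_trans _ Kk).
have k1 : (k.-1.+1 = k)%N by rewrite prednK// (leq_ltn_trans _ Kk).
rewrite /annulus/= k1 xk andbT leNgt; apply/negP => /kmin.
by rewrite -ltnS k1 ltnn.
Qed.

Definition wiener_weight (q : R) (k : nat) : R :=
  ((q `^ (k%:R * (n%:R - alpha)))^-1)%R.

(** Convertible with the general term in [thin_at_infinity], so that the thinness hypothesis applies
    as it stands. *)
Definition wiener_term (A : set 'rV[R]_n) (q : R) (k : nat) : \bar R :=
  capacity alpha (A `&` annulus q k) * (wiener_weight q k)%:E.

Lemma wiener_weight_gt0 q k : (1 < q)%R -> (0 < wiener_weight q k)%R.
Proof. by move=> q1; rewrite invr_gt0 powR_gt0// (lt_trans _ q1). Qed.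

(** The tails of a convergent series tend to 0, hence drop below [C^-1]. Each capacity is finite
    because its product with a positive weight is. *)
Lemma wiener_tail (A : set 'rV[R]_n) q (C : R) : (1 < q)%R -> (0 < C)%R ->
  \sum_(0 <= k <oo) wiener_term A q k < +oo ->
  exists K, (forall k, capacity alpha (A `&` annulus q k) < +oo) /\
    \sum_(0 <= k <oo) C%:E * wiener_term A q (k + K) < 1.
Proof.
move=> q1 C0 sumoo.
pose f := wiener_term A q.
have f0 k : 0 <= f k.
  by rewrite mule_ge0 ?capacity_ge0// lee_fin ltW// wiener_weight_gt0.
have := nneseries_tail_cvg sumoo (fun k _ => f0 k).
have e0 : (0 < C^-1)%R by rewrite invr_gt0.
move=> /fine_cvgP[[K1 _ h1]] /cvgr_lt /(_ _ e0)[K2 _ h2].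
exists (maxn K1 K2); split.
  move=> k; rewrite ltey; apply/negP => /eqP capoo.
  have : f k < +oo.
    apply: le_lt_trans sumoo; rewrite (nneseriesD1 (n := k))// leeDl//.
    exact: nneseries_ge0.
  by rewrite /f /wiener_term capoo gt0_mulye// lte_fin wiener_weight_gt0.
rewrite nneseriesZl// (nneseries_addn (f := f))//.
have := h2 _ (leq_maxr K1 K2); have := h1 _ (leq_maxl K1 K2) => /=.
move=> fin h; rewrite -(fineK fin) -EFinM lte_fin.
by rewrite -ltr_pdivlMl// mulr1.
Qed.

(** Otherwise [mass_le_capacity] bounds the mass on every annulus by [C] times its Wiener term; the
    annuli of index at least [K] cover the carrier of [mu], so its total mass 1 would be less than
    1. *)
Lemma overcharged_annulus (A : set 'rV[R]_n) q C K mu (r : R) :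
  (1 < q)%R -> (0 <= C)%R -> closed A ->
  (forall k, capacity alpha (A `&` annulus q k) < +oo) ->
  \sum_(0 <= k <oo) C%:E * wiener_term A q (k + K) < 1 ->
  (q ^+ K <= r)%R ->
  mu setT = 1 -> mu (~` (A `&` [set x | (r <= enorm x)%R])) = 0 ->
  exists k (mF : measurable (A `&` annulus q k : set T)),
    (C * wiener_weight q k)%:E * mu (A `&` annulus q k) <
    energy alpha (mrestr mu mF) (mrestr mu mF).
Proof.
move=> q1 C0 cA capoo tail Kr muT muC; apply: contrapT => nex.
have mA := closed_borel cA.
have mF k : measurable (A `&` annulus q k : set T).
  by apply: measurableI => //; exact: measurable_annulus.
have muToo : mu setT < +oo by rewrite muT ltry.
have H k : mu (A `&` annulus q (k + K)) <=
    C%:E * wiener_term A q (k + K).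
  rewrite /wiener_term (muleC (capacity _ _)) muleA -EFinM.
  have := @mass_le_capacity (mrestr mu (mF (k + K)%N)) (A `&` annulus q (k + K))
    (C * wiener_weight q (k + K))%R (mF _) (mrestrC0 _ _)
    (mrestr_lty _ muToo) (capoo _).
  rewrite /= /mrestr setIid; apply.
    by rewrite mulr_ge0// ltW// wiener_weight_gt0.
  rewrite leNgt; apply/negP => h; apply: nex.
  by exists (k + K)%N, (mF _).
pose S := (A `&` [set x | (r <= enorm x)%R]) : set T.
have mS : measurable S by apply: measurableI => //; exact: measurable_enorm_ge.
have muS : mu S = 1 by rewrite -muT (measureTC mu mS) [X in _ + X]muC adde0.
have : S `<=` \bigcup_k (A `&` annulus q (k + K)).
  move=> x [Ax /= rx]; have [k xk] := annulus_cover q1 (le_trans Kr rx).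
  by exists k.
move/(measure_sigma_subadditive mu (fun k => mF (k + K)%N) mS).
rewrite muS leNgt => /negP; apply; apply: le_lt_trans tail.
by apply: lee_nneseries.
Qed.

End rings.

(** * Thinning and escape to infinity *)

Section improvement.
Context {R : realType} {n : nat} (alpha : R).
Hypothesis alphan : (alpha < n%:R)%R.
Local Notation T := (@borelRn R n).
Implicit Types (mu nu lam : {measure set T -> \bar R}).
Local Notation E mu nu := (fine (energy alpha mu nu)).

Lemma energy_separated mu nu (A B : set 'rV[R]_n) (a b d : R) :
  measurable (A : set T) -> measurable (B : set T) ->
  mu (~` A) = 0 -> nu (~` B) = 0 -> mu setT = a%:E -> nu setT = b%:E ->
  (0 < d)%R -> (forall x y, A x -> B y -> (d <= enorm (x - y))%R) ->
  energy alpha mu nu <= (d `^ (alpha - n%:R) * b * a)%:E.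
Proof.
move=> mA mB muA nuB muT nuT d0 dAB; rewrite !EFinM -muT -nuT.
apply: (energy_le mA mB) => //; first exact: powR_ge0.
  by rewrite nuT ltry.
by move=> x y Ax By; apply: riesz_kernel_le => //; exact: dAB.
Qed.

(** Both orders of a mutual energy are carried along separately; this is the swapped bound. *)
Lemma energy_separatedC mu nu (A B : set 'rV[R]_n) (a b d : R) :
  measurable (A : set T) -> measurable (B : set T) ->
  mu (~` A) = 0 -> nu (~` B) = 0 -> mu setT = a%:E -> nu setT = b%:E ->
  (0 < d)%R -> (forall x y, A x -> B y -> (d <= enorm (x - y))%R) ->
  energy alpha nu mu <= (d `^ (alpha - n%:R) * b * a)%:E.
Proof.
move=> mA mB muA nuB muT nuT d0 dAB; rewrite mulrAC.
apply: (energy_separated mB mA) => // x y Bx Ay.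
by rewrite -enormN opprB; exact: dAB.
Qed.

Lemma fine_energy_ge0 mu nu : (0 <= E mu nu)%R.
Proof. by rewrite fine_ge0// energy_ge0. Qed.

Lemma energy_fineK mu nu : energy alpha mu nu < +oo ->
  energy alpha mu nu = (E mu nu)%:E.
Proof. by move=> h; rewrite fineK// ge0_fin_numE// energy_ge0. Qed.

Lemma fine_energy_le mu nu (r : R) : energy alpha mu nu <= r%:E ->
  (E mu nu <= r)%R.
Proof.
move=> h; rewrite -lee_fin -energy_fineK//.
by apply: le_lt_trans h _; exact: ltry.
Qed.

Definition mcomb (a b : {nonneg R}) mu nu : {measure set T -> \bar R} :=
  measure_add (mscale a mu) (mscale b nu).

Lemma mcombE a b mu nu B :
  mcomb a b mu nu B = a%:num%:E * mu B + b%:num%:E * nu B.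
Proof. exact: measure_addE. Qed.

Lemma mscale_lty (a : {nonneg R}) mu : mu setT < +oo -> mscale a mu setT < +oo.
Proof. by move=> muT; rewrite /mscale lte_mul_pinfty. Qed.

Lemma mcomb_lty a b mu nu : mu setT < +oo -> nu setT < +oo ->
  mcomb a b mu nu setT < +oo.
Proof. by move=> muT nuT; rewrite mcombE lte_add_pinfty// lte_mul_pinfty. Qed.

Lemma energy_mcombl a b mu nu lam : lam setT < +oo ->
  energy alpha (mcomb a b mu nu) lam =
  a%:num%:E * energy alpha mu lam + b%:num%:E * energy alpha nu lam.
Proof. by move=> lT; rewrite /mcomb energyDl// !energyZl. Qed.

Lemma energy_mcombr a b mu nu lam : mu setT < +oo -> nu setT < +oo ->
  energy alpha lam (mcomb a b mu nu) =
  a%:num%:E * energy alpha lam mu + b%:num%:E * energy alpha lam nu.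
Proof.
move=> muT nuT.
by rewrite /mcomb energyDr ?mscale_lty// !energyZr.
Qed.

Lemma energy_mcomb a b mu nu : mu setT < +oo -> nu setT < +oo ->
  energy alpha mu mu < +oo -> energy alpha mu nu < +oo ->
  energy alpha nu mu < +oo -> energy alpha nu nu < +oo ->
  energy alpha (mcomb a b mu nu) (mcomb a b mu nu) =
  (a%:num ^+ 2 * E mu mu + a%:num * b%:num * (E mu nu + E nu mu) +
   b%:num ^+ 2 * E nu nu)%:E.
Proof.
move=> muT nuT h1 h2 h3 h4.
rewrite energy_mcombl ?mcomb_lty// !energy_mcombr//.
rewrite (energy_fineK h1) (energy_fineK h2) (energy_fineK h3) (energy_fineK h4).
rewrite -!EFinM -!EFinD /=.
by congr EFin; ring.
Qed.

(** The part of the condenser energy that varies with the second component when [mu1] is fixed. It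
    is real valued, and meaningful when the three energies are finite. *)
Definition net_energy mu1 lam : R := (E lam lam - (E mu1 lam + E lam mu1))%R.

Lemma condenser_energyE mu1 lam :
  energy alpha mu1 mu1 < +oo -> energy alpha mu1 lam < +oo ->
  energy alpha lam mu1 < +oo -> energy alpha lam lam < +oo ->
  condenser_energy alpha (mu1, lam) = (E mu1 mu1 + net_energy mu1 lam)%:E.
Proof.
move=> h1 h2 h3 h4; rewrite /condenser_energy/=.
rewrite (energy_fineK h1) (energy_fineK h2) (energy_fineK h3) (energy_fineK h4).
rewrite -!EFinB -EFinD.
by congr EFin; rewrite /net_energy; ring.
Qed.

(** In [eps] the energy is a quadratic polynomial with slope [- b] at 0, and the exact gain is
    [eps * (b - eps * a)]. Here [a] is the energy of the thinned part, [x + y] its interaction with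
    the rest, [p + q] its interaction with [mu1]. *)
Lemma thinning_gain (a x y p q c u v : R) :
  (0 <= a)%R -> (0 <= x)%R -> (0 <= y)%R -> (p + q < a + a)%R ->
  exists eps, [/\ (0 < eps)%R, (eps < 1)%R &
    ((1 - eps) ^+ 2 * a + (1 - eps) * (x + y) + c -
       ((1 - eps) * p + u + ((1 - eps) * q + v)) <
     a + (x + y) + c - (p + u + (q + v)))%R].
Proof.
move=> a0 x0 y0 over; pose b := (a + a + x + y - (p + q))%R.
have b0 : (0 < b)%R by rewrite /b; lra.
have den : (0 < a + b + 1)%R by lra.
(* This value satisfies both [eps < 1] and [eps * a < b]. *)
exists (b / (a + b + 1))%R; set eps := (_ / _)%R.
have eps0 : (0 < eps)%R by exact: divr_gt0.
split => //; first by rewrite ltr_pdivrMr//; lra.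
have epsb : (eps * a < b)%R.
  by rewrite /eps mulrAC ltr_pdivrMr// ltr_pM2l//; lra.
rewrite -subr_gt0 (_ : (_ - _)%R = (eps * (b - eps * a))%R); last first.
  by rewrite /b; ring.
by rewrite mulr_gt0// subr_gt0.
Qed.

(** The last hypothesis says that the part on [F] repels itself more than [mu1] attracts it; [lam]
    keeps the fraction [1 - eps] of that part and all of the rest. *)
Lemma net_energy_thinning mu1 mu (F : set T) (mF : measurable F) :
  mu1 setT < +oo -> mu setT < +oo -> energy alpha mu mu < +oo ->
  energy alpha mu1 mu < +oo -> energy alpha mu mu1 < +oo ->
  energy alpha mu1 (mrestr mu mF) + energy alpha (mrestr mu mF) mu1 <
    energy alpha (mrestr mu mF) (mrestr mu mF) +
    energy alpha (mrestr mu mF) (mrestr mu mF) ->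
  exists lam : {measure set T -> \bar R},
    [/\ forall B, measurable B -> lam B <= mu B, energy alpha lam lam < +oo &
      (net_energy mu1 lam < net_energy mu1 mu)%R].
Proof.
move=> mu1T muT II h1 h2 over.
have mC := measurableC mF.
set f : {measure set T -> \bar R} := mrestr mu mF in over *.
set c : {measure set T -> \bar R} := mrestr mu mC.
have fT : f setT < +oo by exact: mrestr_lty.
have cT : c setT < +oo by exact: mrestr_lty.
have Iff : energy alpha f f < +oo.
  by apply: le_lt_trans II; exact: energy_mrestr.
have Icc : energy alpha c c < +oo.
  by apply: le_lt_trans II; exact: energy_mrestr.
have Ifc : energy alpha f c < +oo.
  apply: le_lt_trans II; apply: (@le_trans _ _ (energy alpha mu c)).
    exact: energy_mrestrl.
  exact: energy_mrestrr.
have Icf : energy alpha c f < +oo.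
  apply: le_lt_trans II; apply: (@le_trans _ _ (energy alpha mu f)).
    exact: energy_mrestrl.
  exact: energy_mrestrr.
have X1f : energy alpha mu1 f < +oo.
  by apply: le_lt_trans h1; exact: energy_mrestrr.
have X2f : energy alpha f mu1 < +oo.
  by apply: le_lt_trans h2; exact: energy_mrestrl.
have X1c : energy alpha mu1 c < +oo.
  by apply: le_lt_trans h1; exact: energy_mrestrr.
have X2c : energy alpha c mu1 < +oo.
  by apply: le_lt_trans h2; exact: energy_mrestrl.
rewrite (energy_fineK X1f) (energy_fineK X2f) (energy_fineK Iff) in over.
rewrite -!EFinD lte_fin in over.
have [eps [eps0 eps1 less]] := thinning_gain (E c c) (E mu1 c) (E c mu1)
  (fine_energy_ge0 f f) (fine_energy_ge0 f c) (fine_energy_ge0 c f) over.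
have e1 : (0 <= 1 - eps)%R by rewrite subr_ge0 ltW.
pose c1 : {nonneg R} := NngNum e1.
pose one : {nonneg R} := NngNum (@ler01 R).
have c10 : (c1%:num = 1 - eps)%R by [].
have muE B : measurable B -> mu B = mcomb one one f c B.
  by move=> mB; rewrite mcombE !mul1e (mrestrDC mu mF mB) measure_addE.
have EE : energy alpha mu mu = (E f f + (E f c + E c f) + E c c)%:E.
  rewrite (eq_energy alpha muE muE).
  rewrite (energy_mcomb one one fT cT Iff Ifc Icf Icc).
  by rewrite /= !(expr1n, mul1r).
have E1 : energy alpha mu1 mu = (E mu1 f + E mu1 c)%:E.
  rewrite EFinD -(energy_fineK X1f) -(energy_fineK X1c); exact: energy_splitr.
have E2 : energy alpha mu mu1 = (E f mu1 + E c mu1)%:E.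
  rewrite EFinD -(energy_fineK X2f) -(energy_fineK X2c); exact: energy_splitl.
pose lam := mcomb c1 one f c.
have LL := energy_mcomb c1 one fT cT Iff Ifc Icf Icc.
have L1 : energy alpha mu1 lam = ((1 - eps) * E mu1 f + E mu1 c)%:E.
  rewrite EFinD EFinM -(energy_fineK X1f) -(energy_fineK X1c).
  by rewrite energy_mcombr//= mul1e.
have L2 : energy alpha lam mu1 = ((1 - eps) * E f mu1 + E c mu1)%:E.
  rewrite EFinD EFinM -(energy_fineK X2f) -(energy_fineK X2c).
  by rewrite energy_mcombl//= mul1e.
exists lam; split.
- move=> B mB; rewrite mcombE (mrestrDC mu mF mB) measure_addE mul1e leeD2r//.
  by rewrite -[leRHS]mul1e lee_wpmul2r// lee_fin c10 gerBl ltW.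
- by rewrite LL ltry.
- by rewrite /net_energy LL L1 L2 EE E1 E2 /= expr1n !mul1r mulr1.
Qed.

Lemma powR_small (r d : R) : (0 < d)%R -> exists M : R,
  [/\ (0 < M)%R, (r <= M)%R & (M `^ (alpha - n%:R) < d)%R].
Proof.
move=> d0; pose p := (n%:R - alpha)%R.
have p0 : (0 < p)%R by rewrite subr_gt0.
(* Chosen so that [s] to the power [- p] equals [d / 2]. *)
pose s := ((2 / d) `^ (p^-1))%R.
have d20 : (0 < 2 / d)%R by rewrite divr_gt0.
have s0 : (0 < s)%R by rewrite powR_gt0.
exists (Num.max r s); rewrite lt_max s0 orbT le_max lexx; split => //.
apply: (@le_lt_trans _ _ (s `^ (alpha - n%:R))%R).
  rewrite -(opprB n%:R alpha) !powRN.
  rewrite lef_pV2 ?posrE ?powR_gt0// ?lt_max ?s0 ?orbT//.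
  apply: ge0_ler_powR; first exact: ltW.
  - by rewrite nnegrE ltW.
  - by rewrite nnegrE le_max (ltW s0) orbT.
  - by rewrite le_max lexx orbT.
rewrite -(opprB n%:R alpha) powRN -powRrM mulVf ?gt_eqF// powRr1 ?ltW//.
by rewrite invf_div ltr_pdivrMr// ltr_pMr// ltr1n.
Qed.

(** Error count: at most [4 * g] from the interaction with the escaping measure, [t] from its own
    energy, [2 * t] from weakening the attraction of the near part, [2 * g] from dropping the far
    part. In all [6 * g + 3 * t], less than 9/12 of [eta]. *)
Lemma escape_bound (t g w m k eta ell elam x1 x2 y1 y2 z1 z2 e u1 u2 : R) :
  (0 <= t)%R -> (t <= 1)%R -> (t * w <= 2)%R -> (t < eta / 12)%R ->
  (0 <= g)%R -> (g < eta / 12)%R -> (0 <= w)%R -> (m <= 1)%R -> (k <= 1)%R ->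
  (0 <= ell)%R -> (0 <= z1)%R -> (0 <= z2)%R -> (0 <= e)%R ->
  (0 <= u1)%R -> (0 <= u2)%R ->
  (z1 <= g * w * m)%R -> (z2 <= g * w * m)%R ->
  (y1 <= g * k)%R -> (y2 <= g * k)%R ->
  (x1 <= m)%R -> (x2 <= m)%R -> (e <= 1)%R -> (ell <= elam)%R ->
  ((1 - t) ^+ 2 * ell + (1 - t) * t * (z1 + z2) + t ^+ 2 * e -
    ((1 - t) * x1 + t * u1 + ((1 - t) * x2 + t * u2)) <
   elam - (x1 + y1 + (x2 + y2)) + eta)%R.
Proof.
move=> t0 t1 tw teta g0 geta w0 m1 k1 ell0 z10 z20 e0 u10 u20.
move=> z1le z2le y1le y2le x1le x2le ele elle.
have H1 : ((1 - t) ^+ 2 * ell <= elam)%R.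
  apply: le_trans elle; rewrite ler_piMl//.
  by rewrite exprn_ile1// ?subr_ge0// gerBl.
have H2 : ((1 - t) * t * (z1 + z2) <= 4 * g)%R.
  apply: (@le_trans _ _ (t * (z1 + z2))%R).
    by rewrite -mulrA ler_piMl ?gerBl// mulr_ge0// addr_ge0.
  apply: (@le_trans _ _ (t * (2 * (g * w)))%R).
    rewrite ler_wpM2l//.
    have gw : (0 <= g * w)%R by exact: mulr_ge0.
    have h : (g * w * m <= g * w)%R by rewrite ler_piMr.
    rewrite mulr2n mulrDl mul1r; apply: lerD; exact: (le_trans _ h).
  rewrite (_ : t * _ = 2 * (g * (t * w)))%R; last by ring.
  rewrite (_ : 4 * g = 2 * (g * 2))%R; last by ring.
  by rewrite ler_pM2l// ler_wpM2l.
have H3 : (t ^+ 2 * e <= t)%R.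
  by rewrite expr2 -mulrA ler_piMr// mulr_ile1.
have H4 : (g * k <= g)%R by rewrite ler_piMr.
have H5 : (t * x1 <= t)%R by rewrite ler_piMr// (le_trans x1le).
have H6 : (t * x2 <= t)%R by rewrite ler_piMr// (le_trans x2le).
have H7 : (0 <= t * u1)%R by rewrite mulr_ge0.
have H8 : (0 <= t * u2)%R by rewrite mulr_ge0.
have e1 : ((1 - t) * x1 = x1 - t * x1)%R by ring.
have e2 : ((1 - t) * x2 = x2 - t * x2)%R by ring.
rewrite e1 e2.
move: t0 H1 H2 H3 H4 H5 H6 H7 H8 y1le y2le teta geta.
by clear => *; lra.
Qed.


(** The ratio is the [t] solving [(1 - t) * m + t * w = 1], which restores unit mass. The bound on
    [t * w] keeps the interaction with a measure of large mass [w] under control. *)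
Lemma escape_time (m j w : R) : (0 <= m)%R -> (m <= 1)%R -> (1 <= j)%R ->
  (w = j + 1)%R ->
  [/\ (0 < w - m)%R, ((1 - m) / (w - m) <= j^-1)%R &
    ((1 - m) / (w - m) * w <= 2)%R].
Proof.
move=> m0 m1 j1 ->; have d0 : (0 < j + 1 - m)%R by lra.
have j0 : (0 < j)%R by lra.
have mj : (m <= m * j)%R by rewrite ler_peMr.
split => //.
- rewrite ler_pdivrMr// mulrC ler_pdivlMr// mulrBl; lra.
- rewrite mulrAC ler_pdivrMr// mulrBl mulrDr; lra.
Qed.

(* Cutting lam off outside the ball of radius 2M makes nu j far from it, and
   t is of order 1/j, which compensates for the mass j + 1 of nu j. *)
Lemma net_energy_escape mu1 lam (A1 : set 'rV[R]_n) (r0 R1 eta : R)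
    (nu : nat -> {measure set T -> \bar R}) :
  measurable (A1 : set T) -> mu1 (~` A1) = 0 -> mu1 setT = 1 ->
  A1 `<=` [set x | (enorm x <= R1)%R] -> (2 * R1 <= r0)%R -> (2 <= r0)%R ->
  lam setT <= 1 -> lam (~` [set x | (r0 <= enorm x)%R]) = 0 ->
  energy alpha lam lam < +oo ->
  (forall j, [/\ nu j setT = j.+1%:R%:E,
     nu j (~` [set x | (r0 + j%:R <= enorm x)%R]) = 0 &
     energy alpha (nu j) (nu j) <= 1]) ->
  (0 < eta)%R ->
  exists j (t : R) (mu' : {measure set T -> \bar R}), [/\ (0 <= t <= 1)%R,
    mu' setT = 1, energy alpha mu' mu' < +oo,
    forall B, measurable B -> mu' B <= (1 - t)%:E * lam B + t%:E * nu j B &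
    (net_energy mu1 mu' < net_energy mu1 lam + eta)%R].
Proof.
move=> mA1 mu1A mu1T A1R R1r0 r02 lT lC Il hnu eta0.
have lToo : lam setT < +oo by rewrite (le_lt_trans lT)// ltry.
have mu1Too : mu1 setT < +oo by rewrite mu1T ltry.
pose S r : set 'rV[R]_n := [set x | (r <= enorm x)%R].
have mS r : measurable (S r : set T) by exact: measurable_enorm_ge.
have eta12 : (0 < eta / 12)%R by rewrite divr_gt0.
(* Beyond distance [M] the kernel is at most [g], which is below [eta / 12]. *)
have [M [M0 R1M gM]] := powR_small R1 eta12.
set g := (M `^ _)%R in gM.
have g0 : (0 <= g)%R by exact: powR_ge0.
pose B : set 'rV[R]_n := [set x | (enorm x < 2 * M)%R].
have mB : measurable (B : set T) by exact: measurable_enorm_lt.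
pose l := mrestr lam mB : {measure set T -> \bar R}.
pose h := mrestr lam (measurableC mB) : {measure set T -> \bar R}.
have lTf : l setT <= 1.
  by apply: le_trans lT; rewrite /l/= /mrestr setTI le_measure// inE.
have hTf : h setT <= 1.
  apply: le_trans lT; rewrite /h/= /mrestr setTI le_measure// inE//.
  exact: measurableC.
have ll : l setT < +oo by rewrite (le_lt_trans lTf)// ltry.
have hh : h setT < +oo by rewrite (le_lt_trans hTf)// ltry.
set m := fine (l setT).
have mE : l setT = m%:E by rewrite fineK// ge0_fin_numE.
have m0 : (0 <= m)%R by rewrite fine_ge0.
have m1 : (m <= 1)%R by rewrite -lee_fin -mE.
set k := fine (h setT).
have kE : h setT = k%:E by rewrite fineK// ge0_fin_numE.
have k0 : (0 <= k)%R by rewrite fine_ge0.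
have k1 : (k <= 1)%R by rewrite -lee_fin -kE.
have [j [jM j2 jt]] : exists j : nat,
    [/\ (3 * M <= j%:R)%R, (1 <= j)%N & (j%:R^-1 < eta / 12)%R].
  (* The first bound puts [nu j] at distance at least [M] from the ball of radius [2 * M]; the
     second makes [t] smaller than [eta / 12]. *)
  pose z := (Num.max (3 * M) (eta / 12)^-1)%R.
  have zj : (z < (Num.bound z)%:R)%R.
    by apply: archi_boundP; rewrite le_max mulr_ge0// ltW.
  move: zj; rewrite gt_max => /andP[z1 z2].
  have b0 : (0 < (Num.bound z)%:R :> R)%R.
    by apply: lt_trans z1; rewrite mulr_gt0.
  exists (Num.bound z); split.
  - exact: ltW.
  - by rewrite -(ltr_nat R).
  - by rewrite -(invrK (eta / 12)%R) ltf_pV2// posrE invr_gt0.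
have [nuT nuC Inu] := hnu j.
set w : R := j.+1%:R.
have wE : w = (j%:R + 1)%R by rewrite /w -natr1.
have j1 : (1 <= j%:R :> R)%R by rewrite ler1n.
have w0 : (0 <= w)%R by exact: ler0n.
have [wm0 tj tw] := escape_time m0 m1 j1 wE.
set t := ((1 - m) / (w - m))%R in tj tw.
have t0 : (0 <= t)%R by apply: divr_ge0; [rewrite subr_ge0|exact: ltW].
have teta : (t < eta / 12)%R by exact: (le_lt_trans tj).
have t1 : (t <= 1)%R by rewrite (le_trans tj)// invf_le1// (lt_le_trans ltr01).
have t10 : (0 <= 1 - t)%R by rewrite subr_ge0.
have nT : nu j setT < +oo by rewrite nuT ltry.
have ln x y : B x -> S (r0 + j%:R)%R y -> (M <= enorm (x - y))%R.
  rewrite /B /S/= => Bx Sy; apply: le_trans (enormB_ge _ _).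
  by move: jM Sy Bx r02; clear => *; lra.
have lC0 : l (~` B) = 0 by exact: mrestrC0.
have Iln : energy alpha l (nu j) <= (g * w * m)%:E.
  exact: (energy_separated mB (mS _) lC0 nuC mE nuT M0 ln).
have Inl : energy alpha (nu j) l <= (g * w * m)%:E.
  exact: (energy_separatedC mB (mS _) lC0 nuC mE nuT M0 ln).
(* Points of [A1] have norm at most [R1 <= M], and those outside [B] at least [2 * M]. *)
have A1h x y : A1 x -> (~` B) y -> (M <= enorm (x - y))%R.
  move=> /A1R/= xR; rewrite /B/= => /negP; rewrite -leNgt => yM.
  apply: le_trans (enormB_ge _ _).
  by move: R1M xR yM; clear => *; lra.
have hC0 : h (~` ~` B) = 0 by exact: mrestrC0.
have I1h : energy alpha mu1 h <= (g * k * 1)%:E.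
  exact: (energy_separated mA1 (measurableC mB) mu1A hC0 mu1T kE M0 A1h).
have Ih1 : energy alpha h mu1 <= (g * k * 1)%:E.
  exact: (energy_separatedC mA1 (measurableC mB) mu1A hC0 mu1T kE M0 A1h).
(* The gap is at least [r0 - R1], hence at least [r0 / 2 >= 1]. *)
have A1l x y : A1 x -> S r0 y -> (1 <= enorm (x - y))%R.
  move=> /A1R/= xR; rewrite /S/= => yr.
  apply: le_trans (enormB_ge _ _).
  by move: R1r0 r02 xR yr; clear => *; lra.
have lS0 : l (~` S r0) = 0.
  apply: (subset_measure0 _ _ _ lC) => //.
  - by apply: measurableI => //; exact: measurableC.
  - exact: (measurableC (mS r0)).
have I1l : energy alpha mu1 l <= (1 `^ (alpha - n%:R) * m * 1)%:E.
  exact: (energy_separated mA1 (mS _) mu1A lS0 mu1T mE ltr01 A1l).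
have Il1 : energy alpha l mu1 <= (1 `^ (alpha - n%:R) * m * 1)%:E.
  exact: (energy_separatedC mA1 (mS _) mu1A lS0 mu1T mE ltr01 A1l).
have A1n x y : A1 x -> S (r0 + j%:R)%R y -> (1 <= enorm (x - y))%R.
  move=> xA; rewrite /S/= => yr; apply: A1l => //; rewrite /S/=.
  by apply: le_trans yr; rewrite lerDl.
have I1n : energy alpha mu1 (nu j) < +oo.
  apply: le_lt_trans (ltry _).
  exact: (energy_separated mA1 (mS _) mu1A nuC mu1T nuT ltr01 A1n).
have In1 : energy alpha (nu j) mu1 < +oo.
  apply: le_lt_trans (ltry _).
  exact: (energy_separatedC mA1 (mS _) mu1A nuC mu1T nuT ltr01 A1n).
have fin z (r : R) : z <= r%:E -> z < +oo.
  by move=> /le_lt_trans; apply; exact: ltry.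
have IlT : energy alpha l l <= energy alpha lam lam by exact: energy_mrestr.
have IlT' : energy alpha l l <= (E lam lam)%:E by rewrite -energy_fineK.
have Ill : energy alpha l l < +oo by exact: le_lt_trans Il.
pose c1 : {nonneg R} := NngNum t10.
pose c2 : {nonneg R} := NngNum t0.
pose mu' := mcomb c1 c2 l (nu j).
have II : energy alpha mu' mu' = _ :=
  energy_mcomb c1 c2 ll nT Ill (fin _ _ Iln) (fin _ _ Inl) (fin _ _ Inu).
have L1 : energy alpha mu1 mu' = ((1 - t) * E mu1 l + t * E mu1 (nu j))%:E.
  rewrite EFinD !EFinM -(energy_fineK (fin _ _ I1l)) -(energy_fineK I1n).
  exact: energy_mcombr.
have L2 : energy alpha mu' mu1 = ((1 - t) * E l mu1 + t * E (nu j) mu1)%:E.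
  rewrite EFinD !EFinM -(energy_fineK (fin _ _ Il1)) -(energy_fineK In1).
  exact: energy_mcombl.
have D1 : energy alpha mu1 lam = (E mu1 l + E mu1 h)%:E.
  rewrite EFinD -(energy_fineK (fin _ _ I1l)) -(energy_fineK (fin _ _ I1h)).
  exact: energy_splitr.
have D2 : energy alpha lam mu1 = (E l mu1 + E h mu1)%:E.
  rewrite EFinD -(energy_fineK (fin _ _ Il1)) -(energy_fineK (fin _ _ Ih1)).
  exact: energy_splitl.
exists j, t, mu'; split.
- by rewrite t0.
- rewrite mcombE mE nuT /= -!EFinM -EFinD; congr EFin; rewrite -/w /t; field.
  by rewrite (addrC 1%R) -wE gt_eqF.
- by rewrite II ltry.
- move=> D mD; rewrite mcombE leeD2r// lee_wpmul2l// ?lee_fin//.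
  by rewrite /l/= /mrestr le_measure// inE//; exact: measurableI.
- rewrite /net_energy II L1 L2 D1 D2 /=.
  have := fine_energy_le IlT'; have := fine_energy_le Inu.
  have := fine_energy_le Il1; have := fine_energy_le I1l.
  have := fine_energy_le Ih1; have := fine_energy_le I1h.
  have := fine_energy_le Inl; have := fine_energy_le Iln.
  rewrite powR1 !mul1r !mulr1.
  have := fine_energy_ge0 mu1 (nu j); have := fine_energy_ge0 (nu j) mu1.
  have := fine_energy_ge0 l l; have := fine_energy_ge0 l (nu j).
  have := fine_energy_ge0 (nu j) l; have := fine_energy_ge0 (nu j) (nu j).
  have := fine_energy_ge0 mu1 l; have := fine_energy_ge0 l mu1.
  move=> x20 x10 e0 z20 z10 ell0 u20 u10 z1le z2le y1le y2le x1le x2le ele elle.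
  apply: (@escape_bound t g w m k) => //.
Qed.

End improvement.

(** * Supports and Radon measures *)

Section constraint.
Context {R : realType} {n : nat} (alpha : R).
Local Notation T := (@borelRn R n).
Implicit Types (mu nu tau dl : {measure set T -> \bar R}).

Lemma compact_enorm_bounded (K : set 'rV[R]_n) : compact K ->
  exists M : R, forall x, K x -> (enorm x <= M)%R.
Proof.
move=> cK.
have : compact (@enorm R n @` K).
  apply: continuous_compact => //; apply: continuous_subspaceT.
  exact: enorm_continuous.
move=> /compact_bounded[M [_ hM]]; exists (M + 1)%R => x Kx.
apply: le_trans (ler_norm _) _; apply: (hM (M + 1)%R); first by rewrite ltrDl.
by exists x.
Qed.

Lemma measure_le0 mu (A B : set T) : measurable A -> measurable B -> A `<=` B ->
  mu B = 0 -> mu A = 0.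
Proof. by move=> mA mB AB; exact: subset_measure0. Qed.

Lemma msupport_sub mu (A : set 'rV[R]_n) : closed A -> mu (~` A) = 0 ->
  msupport mu `<=` A.
Proof.
move=> cA muA x xmu; apply: contrapT => Ax.
have : 0 < mu (~` A) by apply: xmu; split => //; exact: closed_openC.
by rewrite [X in _ < X]muA ltxx.
Qed.

(** The summand [dl] charges every open set meeting [A], so it alone fills up the support. *)
Lemma msupport_add mu dl (A : set 'rV[R]_n) : closed A -> mu (~` A) = 0 ->
  dl (~` A) = 0 -> (forall U, open U -> U `&` A !=set0 -> 0 < dl U) ->
  msupport (measure_add mu dl : {measure set T -> \bar R}) = A.
Proof.
move=> cA muA dlA dlU; apply/seteqP; split.
  apply: msupport_sub => //.
  by rewrite [LHS]measure_addE [X in X + _]muA [X in _ + X]dlA adde0.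
move=> x Ax U [oU Ux]; rewrite [ltRHS]measure_addE.
apply: (@lt_le_trans _ _ (dl U)); first by apply: dlU => //; exists x.
by rewrite leeDr.
Qed.

(** Links the kernel at half the inner radius of an annulus to the Wiener weight; the constant 2^(n
    - alpha) arises here. *)
Lemma wiener_weightE (q : R) k : (1 < q)%R ->
  ((q ^+ k / 2) `^ (alpha - n%:R) =
   2 `^ (n%:R - alpha) * @wiener_weight R n alpha q k)%R.
Proof.
move=> q1; have q0 : (0 < q)%R by exact: lt_trans q1.
rewrite -(opprB n%:R alpha) powRN /wiener_weight powRrM powR_mulrn ?ltW//.
have -> : ((q ^+ k / 2) `^ (n%:R - alpha) =
  (q ^+ k) `^ (n%:R - alpha) / 2 `^ (n%:R - alpha))%R.
  rewrite powRM ?exprn_ge0 ?ltW//.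
  by rewrite -[(2^-1)%R]powR_inv1// -!powRrM mulN1r powRN.
by rewrite invf_div.
Qed.

(** A compact set is bounded, so only finitely many [nu j] charge it. *)
Lemma far_series_radon (nu : nat -> {measure set T -> \bar R}) (r0 : R) :
  (forall j, nu j setT < +oo) ->
  (forall j, nu j (~` [set x | (r0 + j%:R <= enorm x)%R]) = 0) ->
  radon (mseries nu 0 : {measure set T -> \bar R}).
Proof.
move=> nuT nuC K cK.
have mK : measurable (K : set T).
  by apply: closed_borel; apply: compact_closed => //; exact: norm_hausdorff.
have [M KM] := compact_enorm_bounded cK.
have nK j : (M < r0 + j%:R)%R -> nu j K = 0.
  move=> Mj; apply: (measure_le0 mK _ _ (nuC j)).
    by apply: measurableC; exact: measurable_enorm_ge.
  by move=> x /KM xM /=; apply/negP; rewrite -ltNge (le_lt_trans xM).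
pose N := Num.bound `|M - r0|%R.
have hN j : (N <= j)%N -> (M < r0 + j%:R)%R.
  move=> Nj; rewrite -ltrBlDl; apply: le_lt_trans (ler_norm _) _.
  by apply: (lt_le_trans (archi_boundP (normr_ge0 _))); rewrite ler_nat.
rewrite /= /mseries (nneseries_split 0 N)//= add0n eseries0 ?adde0; last first.
  by move=> j Nj _; apply: nK; exact: hN.
apply: lte_sum_pinfty => j _; apply: le_lt_trans (nuT j).
by apply: le_measure => //; rewrite inE.
Qed.

End constraint.

(** * Cross energies with a measure on the compact plate *)

Section nonattained.
Context {R : realType} {n : nat} (alpha : R).
Local Notation T := (@borelRn R n).
Implicit Types (mu nu : {measure set T -> \bar R}).
Hypothesis alphan : (alpha < n%:R)%R.

Lemma cross_energy_lty mu1 nu (A1 : set 'rV[R]_n) (R1 r0 : R) :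
  measurable (A1 : set T) -> mu1 (~` A1) = 0 -> mu1 setT = 1 ->
  (forall x, A1 x -> (enorm x <= R1)%R) -> (2 * R1 <= r0)%R -> (2 <= r0)%R ->
  nu setT < +oo ->
  nu (~` [set x | (r0 <= enorm x)%R]) = 0 ->
  energy alpha mu1 nu < +oo /\ energy alpha nu mu1 < +oo.
Proof.
move=> mA1 mu1A mu1T A1R R1r0 r02 nuT nuC.
have nuE : nu setT = (fine (nu setT))%:E by rewrite fineK// ge0_fin_numE.
have A1n x y : A1 x -> [set x | (r0 <= enorm x)%R] y -> (1 <= enorm (x - y))%R.
  move=> /A1R/= xR /= yr; apply: le_trans (enormB_ge _ _).
  by move: R1r0 r02 xR yr; clear => *; lra.
split; apply: le_lt_trans (ltry _).
- exact: (energy_separated alphan mA1 (measurable_enorm_ge r0)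
    mu1A nuC mu1T nuE ltr01 A1n).
- exact: (energy_separatedC alphan mA1 (measurable_enorm_ge r0)
    mu1A nuC mu1T nuE ltr01 A1n).
Qed.

(** For [x] in [A1] and [y] with [r0 <= enorm y], the inequality [2 * R1 <= r0] makes the distance
    at least half of [enorm y], hence at least [q ^+ k / 2] on the annulus. *)
Lemma cross_energy_annulus mu1 nu (A1 A : set 'rV[R]_n) (R1 r0 : R) q k
    (mF : measurable (A `&` annulus q k : set T)) :
  measurable (A1 : set T) -> mu1 (~` A1) = 0 -> mu1 setT = 1 ->
  (forall x, A1 x -> (enorm x <= R1)%R) -> (2 * R1 <= r0)%R ->
  measurable (A : set T) ->
  (1 < q)%R -> nu setT < +oo ->
  nu (~` (A `&` [set x | (r0 <= enorm x)%R])) = 0 ->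
  energy alpha mu1 (mrestr nu mF) <=
    (2 `^ (n%:R - alpha) * @wiener_weight R n alpha q k)%:E *
    nu (A `&` annulus q k) /\
  energy alpha (mrestr nu mF) mu1 <=
    (2 `^ (n%:R - alpha) * @wiener_weight R n alpha q k)%:E *
    nu (A `&` annulus q k).
Proof.
move=> mA1 mu1A mu1T A1R R1r0 mA q1 nuT nuC.
set f : {measure set T -> \bar R} := mrestr nu mF.
have fT : f setT = nu (A `&` annulus q k) by rewrite /f/= /mrestr setTI.
have fE : f setT = (fine (f setT))%:E.
  by rewrite fineK// ge0_fin_numE// fT measure_lty.
(* The annulus may reach inside the ball of radius [r0], where [nu] has no mass. *)
pose B : set 'rV[R]_n := (A `&` annulus q k) `&` [set x | (r0 <= enorm x)%R].
have mB : measurable (B : set T).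
  by apply: measurableI => //; exact: measurable_enorm_ge.
have fB : f (~` B) = 0.
  rewrite /f/= /mrestr; apply: (measure_le0 _ _ _ nuC).
  - by apply: measurableI => //; exact: measurableC.
  - by apply: measurableC; apply: measurableI => //; exact: measurable_enorm_ge.
  - by move=> x [nB [Ax qx]] [_ rx]; apply: nB.
have q0 : (0 < q ^+ k / 2)%R by rewrite divr_gt0// exprn_gt0// (lt_trans _ q1).
have sep x y : A1 x -> B y -> (q ^+ k / 2 <= enorm (x - y))%R.
  move=> /A1R xR [[_ /andP[qy _]] /= ry]; apply: le_trans (enormB_ge _ _).
  by move: R1r0 xR qy ry; clear => *; lra.
rewrite -fT fE -wiener_weightE// -EFinM; split.
- have := energy_separated alphan mA1 mB mu1A fB mu1T fE q0 sep.
  by rewrite mulr1.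
- have := energy_separatedC alphan mA1 mB mu1A fB mu1T fE q0 sep.
  by rewrite mulr1.
Qed.

(** Since [mu] ignores [D] and [dl] lives on [D], the comparison can be made on [B] minus [D], where
    [dl] vanishes. *)
Lemma le_of_null_atoms mu nu dl (D : set T) : measurable D ->
  (forall B, measurable B -> mu B <= measure_add nu dl B) ->
  mu D = 0 -> dl (~` D) = 0 -> forall B, measurable B -> mu B <= nu B.
Proof.
move=> mD H muD dlD B mB.
have mBD : measurable (B `\` D) by exact: measurableD.
have -> : mu B = mu (B `\` D).
  rewrite -[RHS]add0e -(measure_le0 _ _ (@subIsetr _ B D) muD)//; last first.
    exact: measurableI.
  by rewrite addeC -measureDI.
apply: le_trans (H _ mBD) _; rewrite measure_addE.
rewrite (measure_le0 mBD _ _ dlD) ?adde0; [|exact: measurableC|by move=> x []].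
by apply: le_measure; rewrite ?inE//; exact: subDsetl.
Qed.

End nonattained.

(** * Construction of the constraint and of a better competitor *)

Theorem theorem7p9 (R : realType) (n : nat) (alpha : R)
    (A1 A2 : set 'rV[R]_n)
    (hn : (3 <= n)%N) (halpha : (0 < alpha <= 2)%R)
    (A2_closed : closed A2) (A2_cap : capacity alpha A2 = +oo)
    (A2_thin : thin_at_infinity alpha A2)
    (D_connected : connected (~` A2))
    (A1_compact : compact A1) (A1_sub : A1 `<=` ~` A2)
    (A1_cap : 0 < capacity alpha A1) :
  exists2 sigma, constraints (A1, A2) sigma &
    [/\ 1 < sigma.1 A1 < +oo, sigma.2 A2 = +oo,
        admissible alpha sigma (A1, A2) !=set0
      & forall nu, admissible alpha sigma (A1, A2) nu ->
          ereal_inf [set condenser_energy alpha mu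
                    | mu in admissible alpha sigma (A1, A2)]
          < condenser_energy alpha nu].
Proof.
pose T := @borelRn R n.
have alphan : (alpha < n%:R)%R.
  by case/andP: halpha => _ /le_lt_trans; apply; rewrite (ltr_nat _ 2).
have A1_closed : closed A1.
  by apply: compact_closed => //; exact: norm_hausdorff.
have mA1 : measurable (A1 : set T) by exact: closed_borel.
have mA2 : measurable (A2 : set T) by exact: closed_borel.
have mS r : measurable ([set x | (r <= enorm x)%R] : set T).
  exact: measurable_enorm_ge.
have [R1 A1R] := compact_enorm_bounded A1_compact.
have [tau [_ tau_fin tau_neg tauA1]] : exists tau : {measure set T -> \bar R},
    [/\ radon tau, energy alpha tau tau < +oo, tau.-negligible (~` A1)
      & tau A1 = 1].
  (* With no such measure the infimum is [+oo], and the capacity 0. *)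
  apply: contrapT => notau; move: A1_cap; rewrite /capacity.
  rewrite (_ : mkset _ = set0); last first.
    by apply/seteqP; split => // mu hmu; apply: notau; exists mu.
  by rewrite image_set0 ereal_inf0 invey ltxx.
have tauC : tau (~` A1) = 0.
  by apply: measure_negligible => //; exact: measurableC.
have tauT : tau setT = 1.
  by rewrite (measureTC tau mA1) [X in X + _]tauA1 [X in _ + X]tauC adde0.
have [q q1 thin] := A2_thin.
(* The factor from [cross_energy_annulus], which the Wiener tail has to absorb. *)
have C0 : (0 < 2 `^ (n%:R - alpha) :> R)%R by exact: powR_gt0.
have [K [capoo tail]] := wiener_tail q1 C0 thin.
(* The first two terms separate the far region from [A1]; the third places it inside the annuli of
   the Wiener tail. *)
pose r0 : R := (Num.max (Num.max 2 (2 * R1)) (q ^+ K))%R.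
have r02 : (2 <= r0)%R by rewrite !le_max lexx.
have R1r0 : (2 * R1 <= r0)%R by rewrite !le_max lexx orbT.
have Kr0 : (q ^+ K <= r0)%R by rewrite le_max lexx orbT.
have /choice[nu hnu] : forall j : nat, exists nu : {measure set T -> \bar R},
    [/\ nu setT = j.+1%:R%:E,
        nu (~` (A2 `&` [set x | (r0 + j%:R <= enorm x)%R])) = 0 &
        energy alpha nu nu <= 1].
  move=> j; apply: capacityy_far_measure => //.
  by rewrite ltr_wpDr// (lt_le_trans _ r02).
have nuT j : nu j setT < +oo by have [-> _ _] := hnu j; rewrite ltry.
have nuS j : nu j (~` [set x | (r0 + j%:R <= enorm x)%R]) = 0.
  have [_ nuC _] := hnu j; apply: measure_le0 nuC.
  - exact: measurableC.
  - by apply: measurableC; exact: measurableI.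
  - by move=> x nx [].
have nuA2C j : nu j (~` A2) = 0.
  have [_ nuC _] := hnu j; apply: measure_le0 nuC.
  - exact: measurableC.
  - by apply: measurableC; exact: measurableI.
  - by move=> x nx [].
have nuA2 j : nu j A2 = j.+1%:R%:E.
  have [<- _ _] := hnu j.
  by rewrite (measureTC (nu j) mA2) [X in _ + X]nuA2C adde0.
have nur0 j : nu j (~` (A2 `&` [set x | (r0 <= enorm x)%R])) = 0.
  have [_ nuC _] := hnu j; apply: measure_le0 nuC.
  - by apply: measurableC; exact: measurableI.
  - by apply: measurableC; exact: measurableI.
  - move=> x nx [Ax /= rx]; apply: nx; split => //=.
    by rewrite (le_trans _ rx)// lerDl.
pose rho : {measure set T -> \bar R} := mseries nu 0.
have nu_rho j B : nu j B <= rho B.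
  rewrite /rho/= /mseries (nneseriesD1 (n := j))// leeDl//.
  by apply: nneseries_ge0 => i _ _; exact: measure_ge0.
have rho_radon : radon rho by exact: (far_series_radon nuT nuS).
have rho0 : rho (~` (A2 `&` [set x | (r0 <= enorm x)%R])) = 0.
  by rewrite /rho/= /mseries eseries0.
have rhoA2C : rho (~` A2) = 0.
  by rewrite /rho/= /mseries eseries0.
have rhoA2 : rho A2 = +oo.
  apply/eqP; rewrite -leye_eq leNgt; apply/negP => rhooo.
  have rE : rho A2 = (fine (rho A2))%:E by rewrite fineK// ge0_fin_numE.
  (* A single [nu j] of large index already has more mass than a finite value of [rho A2]. *)
  have := nu_rho (Num.bound (fine (rho A2))) A2.
  rewrite nuA2 rE lee_fin leNgt => /negP; apply.
  apply: (lt_trans (archi_boundP (fine_ge0 (measure_ge0 _ _)))).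
  by rewrite ltr_nat.
have A1_0 : A1 !=set0.
  apply/set0P/eqP => A10; move: tauA1; rewrite A10 measure0 => /eqP.
  by rewrite eq_sym onee_eq0.
have A2_0 : A2 !=set0.
  by apply/set0P/eqP => A20; move: rhoA2; rewrite A20 measure0.
have [x1 [d1 [x1A d1T d1C d1U]]] := dense_atoms A1_0.
have [x2 [d2 [x2A d2T d2C d2U]]] := dense_atoms A2_0.
have mx1 : measurable (range x1 : set T) by exact: borel_range.
have mx2 : measurable (range x2 : set T) by exact: borel_range.
have d1A : d1 (~` A1) = 0.
  apply: measure_le0 d1C => //; [exact: measurableC|exact: measurableC|].
  exact: subsetC.
have d2A : d2 (~` A2) = 0.
  apply: measure_le0 d2C => //; [exact: measurableC|exact: measurableC|].
  exact: subsetC.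
have d1A1 : d1 A1 = 1.
  by rewrite -d1T (measureTC d1 mA1) [X in _ + X]d1A adde0.
pose s1 : {measure set T -> \bar R} := measure_add tau d1.
pose s2 : {measure set T -> \bar R} := measure_add rho d2.
have s1E B : s1 B = tau B + d1 B by exact: measure_addE.
have s2E B : s2 B = rho B + d2 B by exact: measure_addE.
have s1A1 : s1 A1 = 2%:R%:E.
  by rewrite s1E [X in X + _]tauA1 [X in _ + X]d1A1 -EFinD.
have s2A2 : s2 A2 = +oo.
  rewrite s2E [X in X + _]rhoA2 addye// gt_eqF//.
  by rewrite (lt_le_trans _ (measure_ge0 _ _)).
have tau_s1 B : tau B <= s1 B by rewrite s1E leeDl.
have rho_s2 B : rho B <= s2 B by rewrite s2E leeDl.
have s_constr : constraints (A1, A2) (s1, s2).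
  split => /=; split.
  - by apply: finite_radon; rewrite s1E tauT d1T -EFinD ltry.
  - exact: msupport_add.
  - by rewrite s1A1 lte_fin ltr1n.
  - move=> Q cQ; rewrite s2E lte_add_pinfty//; first exact: rho_radon.
    by apply: finite_radon cQ; rewrite d2T ltry.
  - exact: msupport_add.
  - by rewrite s2A2 ltry.
exists (s1, s2) => //; split => /=.
- by rewrite s1A1 lte_fin ltr1n ltry.
- exact: s2A2.
(* Nonemptiness keeps the final claim from being vacuous; [nu 0%N] has mass exactly 1 because [nu j]
   has mass [j.+1]. *)
- exists (tau, nu 0%N); split => /=; split.
  + by apply: finite_radon; rewrite tauT ltry.
  + exact: msupport_sub.
  + exact: tau_fin.
  + by move=> B _; exact: tau_s1.
  + exact: tauA1.
  + exact: finite_radon.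
  + exact: msupport_sub.
  + by have [_ _ /le_lt_trans] := hnu 0%N; apply; rewrite ltry.
  + by move=> B _; exact: le_trans (nu_rho 0%N B) (rho_s2 B).
  + exact: nuA2.
move=> [mu1 mu] [/= adm1 [mu_radon _ mu_fin mu_s2 muA2]].
have [_ _ mu1_fin mu1_s1 mu1A1] := adm1.
have mCA1 := measurableC mA1.
have mCA2 := measurableC mA2.
have mu1C : mu1 (~` A1) = 0.
  apply/eqP; rewrite eq_le measure_ge0 andbT (le_trans (mu1_s1 _ mCA1))//.
  by rewrite [leLHS]s1E [X in X + _]tauC [X in _ + X]d1A adde0.
have mu1T : mu1 setT = 1.
  by rewrite (measureTC mu1 mA1) [X in X + _]mu1A1 [X in _ + X]mu1C adde0.
have muC : mu (~` A2) = 0.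
  apply/eqP; rewrite eq_le measure_ge0 andbT (le_trans (mu_s2 _ mCA2))//.
  by rewrite [leLHS]s2E [X in X + _]rhoA2C [X in _ + X]d2A adde0.
have muT : mu setT = 1.
  by rewrite (measureTC mu mA2) [X in X + _]muA2 [X in _ + X]muC adde0.
have muToo : mu setT < +oo by rewrite muT ltry.
have mu1Too : mu1 setT < +oo by rewrite mu1T ltry.
(* Finite energy forbids charging the atoms of [d2], so [mu] lies below [rho] alone and inherits its
   carrier. *)
have mu_rho B : measurable B -> mu B <= rho B.
  move=> mB; apply: (le_of_null_atoms mx2 mu_s2 _ d2C) => //.
  exact: energy_range0 mu_fin.
have mASC : measurable (~` (A2 `&` [set x | (r0 <= enorm x)%R]) : set T).
  by apply: measurableC; exact: measurableI.
have muS : mu (~` (A2 `&` [set x | (r0 <= enorm x)%R])) = 0.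
  by apply/eqP; rewrite eq_le measure_ge0 andbT -rho0 mu_rho.
have mSC : measurable (~` [set x | (r0 <= enorm x)%R] : set T).
  exact: measurableC.
have SAS : ~` [set x | (r0 <= enorm x)%R] `<=`
    ~` (A2 `&` [set x | (r0 <= enorm x)%R]).
  by apply: subsetC => x [].
have muS' := measure_le0 mSC mASC SAS muS.
have [k [mF over]] :=
  overcharged_annulus q1 (ltW C0) A2_closed capoo tail Kr0 muT muS.
have [X1 X2] :=
  cross_energy_annulus alphan mF mA1 mu1C mu1T A1R R1r0 mA2 q1 muToo muS.
have [Y1 Y2] := cross_energy_lty alphan mA1 mu1C mu1T A1R R1r0 r02 muToo muS'.
(* Both cross energies lie below the energy of the part of [mu] on the overcharged annulus; adding
   the two gives the thinning hypothesis. *)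
have [|lam [lam_mu lam_fin lam_lt]] :=
    net_energy_thinning (mF := mF) mu1Too muToo mu_fin Y1 Y2.
  by apply: le_lt_trans (leeD X1 X2) _; exact: lteD.
have lamT : lam setT <= 1 by rewrite -muT lam_mu.
have lamS : lam (~` [set x | (r0 <= enorm x)%R]) = 0.
  by apply/eqP; rewrite eq_le measure_ge0 andbT -muS' lam_mu.
(* The gain from thinning is the budget for restoring the missing mass at infinity. *)
pose eta := (net_energy alpha mu1 mu - net_energy alpha mu1 lam)%R.
have eta0 : (0 < eta)%R by rewrite subr_gt0.
have hnu' j : [/\ nu j setT = j.+1%:R%:E,
    nu j (~` [set x | (r0 + j%:R <= enorm x)%R]) = 0 &
    energy alpha (nu j) (nu j) <= 1].
  by have [? _ ?] := hnu j; split.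
have [j [t [mu' [/andP[t0 t1] mu'T mu'_fin mu'_le mu'_lt]]]] :=
  net_energy_escape alphan mA1 mu1C mu1T A1R R1r0 r02 lamT lamS lam_fin hnu'
    eta0.
(* Both [lam] and [nu j] lie below [rho], hence so does their convex combination. *)
have mu'_rho B : measurable B -> mu' B <= rho B.
  move=> mB; apply: le_trans (mu'_le _ mB) _.
  apply: (@le_trans _ _ ((1 - t)%:E * rho B + t%:E * rho B)).
    apply: leeD; apply: lee_wpmul2l; rewrite ?lee_fin ?subr_ge0//.
    by apply: le_trans (lam_mu _ mB) (mu_rho _ mB).
  by rewrite -ge0_muleDl ?lee_fin ?subr_ge0// -EFinD subrK mul1e.
have mu'Too : mu' setT < +oo by rewrite mu'T ltry.
have mu'C : mu' (~` A2) = 0.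
  by apply/eqP; rewrite eq_le measure_ge0 andbT -rhoA2C mu'_rho.
have mu'S : mu' (~` [set x | (r0 <= enorm x)%R]) = 0.
  have rhoS := measure_le0 mSC mASC SAS rho0.
  by apply/eqP; rewrite eq_le measure_ge0 andbT -rhoS mu'_rho.
have [Z1 Z2] := cross_energy_lty alphan mA1 mu1C mu1T A1R R1r0 r02 mu'Too mu'S.
apply: (@le_lt_trans _ _ (condenser_energy alpha (mu1, mu'))).
  apply: ereal_inf_lbound; exists (mu1, mu') => //; split => //=; split.
  - exact: finite_radon.
  - exact: msupport_sub.
  - exact: mu'_fin.
  - by move=> B mB; exact: le_trans (mu'_rho _ mB) (rho_s2 B).
  - by rewrite -mu'T (measureTC mu' mA2) [X in _ + X]mu'C adde0.
rewrite !condenser_energyE// lte_fin ltrD2l.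
by apply: lt_le_trans mu'_lt _; rewrite /eta addrC subrK.
Qed.
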